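(* Let $N,n\ge 1$ and $0\le m\le \min(n,N)$ be integers, let $1\le x_1<\cdots<x_m\le N$ be integers, let $t,A,B,w_1,\dots,w_N$ be complex numbers and let $u_1,\dots,u_n$ be nonzero pairwise distinct complex numbers. Let $W_{N,n,m}(u_1,\dots,u_n|w_1,\dots,w_N|x_1,\dots,x_m)$ be the wavefunction of the six-vertex model with triangular boundary (defined in the context). Then $$W_{N,n,m}(u_1,\dots,u_n|w_1,\dots,w_N|x_1,\dots,x_m)=F_{N,n,m}(u_1,\dots,u_n|w_1,\dots,w_N|x_1,\dots,x_m),$$ where \begin{align*} &F_{N,n,m}(u_1,\dots,u_n|w_1,\dots,w_N|x_1,\dots,x_m)\\ =&\frac{1}{(n-m)!}\sum_{\sigma\in S_n}\ \prod_{j=1}^m\prod_{k=x_j+1}^N(u_{\sigma(j)}-tw_k)\prod_{1\le j<k\le m}\frac{tu_{\sigma(j)}-u_{\sigma(k)}}{u_{\sigma(j)}-u_{\sigma(k)}}(u_{\sigma(j)}u_{\sigma(k)}-1)\\ &\times\prod_{\substack{m+1\le j\le n\\ 1\le k\le N}}(u_{\sigma(j)}-tw_k)\prod_{\substack{m+1\le j\le n\\ 1\le k\le m}}\frac{tu_{\sigma(j)}-u_{\sigma(k)}}{u_{\sigma(j)}-u_{\sigma(k)}}(u_{\sigma(j)}u_{\sigma(k)}-1)\\ &\times\prod_{j=1}^m\prod_{k=1}^{x_j-1}(u_{\sigma(j)}-w_k)\prod_{m+1\le j<k\le n}(u_{\sigma(j)}u_{\sigma(k)}-t)\\ &\times\prod_{j=1}^m(1-t)(u_{\sigma(j)}^2-1)\prod_{j=m+1}^n(Bu_{\sigma(j)}-A),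 \end{align*} with $S_n$ the symmetric group on $\{1,\dots,n\}$ and empty products equal to $1$.
   Context: Each space $W_a$ is a copy of $\mathbb{C}^2$ with basis $|0\rangle_a,|1\rangle_a$ and dual basis ${}_a\langle 0|,{}_a\langle 1|$. $R$-matrix: $R_{ab}(u,w)$ acts on $W_a\otimes W_b$. Writing $[\gamma\delta|\alpha\beta]={}_a\langle\gamma|{}_b\langle\delta|R_{ab}(u,w)|\alpha\rangle_a|\beta\rangle_b$, its nonzero matrix elements are $[00|00]=[11|11]=u-tw$, $[01|01]=t(u-w)$, $[01|10]=(1-t)u$, $[10|01]=(1-t)w$, $[10|10]=u-w$; all others are $0$. $K$-matrix: $K_a(u)$ acts on $W_a$ with matrix elements ${}_a\langle 0|K_a(u)|0\rangle_a=Bu-A$, ${}_a\langle 0|K_a(u)|1\rangle_a=0$, ${}_a\langle 1|K_a(u)|0\rangle_a=u-u^{-1}$, ${}_a\langle 1|K_a(u)|1\rangle_a=Bu^{-1}-A$. Operators act on $W_{-n}\otimes\cdots\otimes W_{-1}\otimes W_1\otimes\cdots\otimes W_N$ (there is no $W_0$), as the identity on the factors not indicated by the subscripts. For $j=1,\dots,n$ define $$T_j(u_1,\dots,u_j|w_1,\dots,w_N)=R_{-j,N}(u_j,w_N)\cdots R_{-j,1}(u_j,w_1)\,R_{-j,-1}(u_ju_1,1)\,R_{-j,-2}(u_ju_2,1)\cdots R_{-j,-j+1}(u_ju_{j-1},1)\,K_{-j}(u_j)$$ (for $j=1$ there are no factors $R_{-j,-i}$). Let $\langle 0^n|={}_{-n}\langle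 0|\otimes\cdots\otimes{}_{-1}\langle 0|$ and $|\Omega\rangle_{n+N}=|0\rangle_{-n}\otimes\cdots\otimes|0\rangle_{-1}\otimes|0\rangle_1\otimes\cdots\otimes|0\rangle_N$. Define the vector in $W_1\otimes\cdots\otimes W_N$ $$|\Psi_{N,n}(u_1,\dots,u_n|w_1,\dots,w_N)\rangle=\langle 0^n|\,T_1(u_1|w_1,\dots,w_N)\,T_2(u_1,u_2|w_1,\dots,w_N)\cdots T_n(u_1,\dots,u_n|w_1,\dots,w_N)\,|\Omega\rangle_{n+N}$$ (partial contraction with $\langle 0^n|$ on $W_{-n}\otimes\cdots\otimes W_{-1}$). For $1\le x_1<\cdots<x_m\le N$, let $\langle x_1\cdots x_m|\in W_1^*\otimes\cdots\otimes W_N^*$ be the tensor product of ${}_k\langle 1|$ for $k\in\{x_1,\dots,x_m\}$ and ${}_k\langle 0|$ for the other $k\in\{1,\dots,N\}$. The wavefunction with triangular boundary is $$W_{N,n,m}(u_1,\dots,u_n|w_1,\dots,w_N|x_1,\dots,x_m)=\langle x_1\cdots x_m|\Psi_{N,n}(u_1,\dots,u_n|w_1,\dots,w_N)\rangle.$$ *)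

(* Defs.v *)
From HB Require Import structures.
From mathcomp Require Import all_boot all_order all_fingroup all_algebra.
From mathcomp Require Import complex reals.

Set Implicit Arguments.
Unset Strict Implicit.
Unset Printing Implicit Defensive.

Import GRing.Theory.
Local Open Scope ring_scope.

Section Sites.
Variables (C : fieldType) (S : finType).

(* A configuration [s] encodes the basis vector (x)_c |s c>_c of the tensor
   product of the spaces W_c, c : S, with [false] for |0> and [true] for |1>;
   a vector of the tensor product is given by its coordinates in this basis. *)
Definition config := {ffun S -> bool}.
Definition state := {ffun config -> C}.

Definition ket (s : config) : state := [ffun s' => (s' == s)%:R].

(* The operator with matrix elements <s|M|s'> = M s s'. *)
Definition op_of (M : config -> config -> C) (v : state) : state :=
  [ffun s => \sum_(s' : config) M s s' * v s'].

Definition agree_off (D : {set S}) (s s' : config) : bool :=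
  [forall c, (c \notin D) ==> (s c == s' c)].

(* [R_elt u w g d a b] is the matrix element [g d | a b]. *)
Definition R_elt (t u w : C) (g d a b : bool) : C :=
  match g, d, a, b with
  | false, false, false, false => u - t * w
  | true, true, true, true => u - t * w
  | false, true, false, true => t * (u - w)
  | false, true, true, false => (1 - t) * u
  | true, false, false, true => (1 - t) * w
  | true, false, true, false => u - w
  | _, _, _, _ => 0
  end.

(* [K_elt u g a] is the matrix element <g|K(u)|a>. *)
Definition K_elt (A B u : C) (g a : bool) : C :=
  match g, a with
  | false, false => B * u - A
  | false, true => 0
  | true, false => u - u^-1
  | true, true => B * u^-1 - A
  end.

(* The factor [agree_off]%:R makes these operators the identity on the spaces
   W_c other than the indicated ones. *)
Definition R_op (t : C) (a b : S) (u w : C) : state -> state :=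
  op_of (fun s s' =>
    R_elt t u w (s a) (s b) (s' a) (s' b) * (agree_off [set a; b] s s')%:R).

Definition K_op (A B : C) (a : S) (u : C) : state -> state :=
  op_of (fun s s' => K_elt A B u (s a) (s' a) * (agree_off [set a] s s')%:R).

End Sites.

Section Wavefunction.
Variables (C : fieldType) (N n : nat) (t A B : C).
Variables (u : 'I_n -> C) (w : 'I_N -> C).

(* Indices are shifted to start at 0: [inl j] is the site -(j+1) and [inr k] is
   the site k+1. *)
Definition site := ('I_n + 'I_N)%type.
Definition aux (j : 'I_n) : site := inl j.
Definition phys (k : 'I_N) : site := inr k.

(* Operator products are compositions, so the rightmost factor acts first. *)
Definition T_op (j : 'I_n) : state C site -> state C site :=
  (\big[comp/id]_(k <- rev (enum 'I_N)) R_op t (aux j) (phys k) (u j) (w k))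
  \o (\big[comp/id]_(i < n | (i < j)%N) R_op t (aux j) (aux i) (u j * u i) 1)
  \o K_op A B (aux j) (u j).

Definition Omega : state C site := ket C [ffun=> false].

Definition join_config (r : config 'I_n) (s : config 'I_N) : config site :=
  [ffun c : site => match c with inl j => r j | inr k => s k end].

(* Partial contraction with <0^n|. *)
Definition contract0 (v : state C site) : state C 'I_N :=
  [ffun s => v (join_config [ffun=> false] s)].

Definition Psi : state C 'I_N :=
  contract0 ((\big[comp/id]_(j < n) T_op j) Omega).

Definition wavefunction (m : nat) (x : 'I_m -> 'I_N) : C :=
  Psi [ffun k => [exists i, x i == k]].

Definition F_sum (m : nat) (hmn : (m <= n)%N) (x : 'I_m -> 'I_N) : C :=
  ((n - m)`!)%:R^-1 *
  \sum_(s : 'S_n)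
    let v (j : 'I_n) := u (s j) in
    let v' (j : 'I_m) := v (widen_ord hmn j) in
    (\prod_(j < m) \prod_(k < N | (x j < k)%N) (v' j - t * w k))
    * (\prod_(j < m) \prod_(k < m | (j < k)%N)
         ((t * v' j - v' k) / (v' j - v' k) * (v' j * v' k - 1)))
    * (\prod_(j < n | (m <= j)%N) \prod_(k < N) (v j - t * w k))
    * (\prod_(j < n | (m <= j)%N) \prod_(k < m)
         ((t * v j - v' k) / (v j - v' k) * (v j * v' k - 1)))
    * (\prod_(j < m) \prod_(k < N | (k < x j)%N) (v' j - w k))
    * (\prod_(j < n | (m <= j)%N) \prod_(k < n | (j < k)%N) (v j * v k - t))
    * (\prod_(j < m) ((1 - t) * (v' j ^+ 2 - 1)))
    * (\prod_(j < n | (m <= j)%N) (B * v j - A)).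

End Wavefunction.

(* Main.v *)
Require Import Defs.
From HB Require Import structures.
From mathcomp Require Import all_boot all_order all_fingroup all_algebra.
From mathcomp Require Import complex reals.
From mathcomp Require Import ring.

Import GRing.Theory.
Local Open Scope ring_scope.

(* The wavefunction is symmetric under exchanging two adjacent auxiliary lines
   (c, u_c), (d, u_d): R_dc(u_d, u_c) can be pulled through the whole operator by
   the Yang-Baxter and reflection equations, and acts as the scalar u_d - t u_c at
   both ends, so the symmetry holds when u_d != t u_c.

   Then the last column is removed. If its site is empty, all the vertices of the
   column are frozen. If it is occupied, the wavefunction is a polynomial of degree
   < n in w_N; at w_N = u_l / t, after moving line l to the front by symmetry, the
   line l is frozen and peels off, so that Lagrange interpolation expresses the
   wavefunction through those with N - 1 columns and n - 1 lines. Splitting S_n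
   according to sigma(m) = l gives the same recurrence for F.

   The exceptional values t = 0 and t = u_j / u_i are reached because both sides
   are polynomial in t. *)

(** Symmetry is what makes freezing possible: only the line that acts first meets every other space
    in the vacuum, so only that line is forced to keep a 1 all the way from its K-matrix. The scalar
    u_d - t u_c arises at both ends because the row and the column of R indexed by 00 are diagonal.
    The node u_l / t is the zero of u_l - t w_N, the weight with which line l passes the last site
    while both carry 0. In the column, exactly one line raises the site; the lines before it have
    this weight, so at the node a line l placed first must itself raise the site. The raising weight
    (1-t)u_l does not contain w_N and the other n - 1 weights are affine in it, whence the degree
    bound that n nodes can match. Generic t is needed twice: to cancel u_d - t u_c and to have the
    nodes. The return to all t works because the denominators of F are differences of the u_j only.
    Spectral parameters are attached to sites by a function [U], so exchanging two lines is just a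
    permutation of a list of sites, with the parameters following their lines. *)

(** * Coordinate form of the R- and K-operators *)

Section LocalOperators.
Context {C : fieldType} {S : finType}.
Implicit Types (s : config S) (v : state C S) (f g : state C S -> state C S).

Definition upd s (c : S) (x : bool) : config S :=
  [ffun d => if d == c then x else s d].

Lemma upd_same s c x : upd s c x c = x.
Proof. by rewrite ffunE eqxx. Qed.

Lemma upd_other s c d x : d != c -> upd s c x d = s d.
Proof. by rewrite ffunE => /negPf ->. Qed.

Lemma upd_id s c x : s c = x -> upd s c x = s.
Proof. by move=> <-; apply/ffunP => d; rewrite ffunE; case: eqP => [->|]. Qed.

Lemma upd_upd s c x y : upd (upd s c x) c y = upd s c y.
Proof. by apply/ffunP => d; rewrite !ffunE; case: eqP. Qed.

Lemma updC s c d x y : c != d -> upd (upd s c x) d y = upd (upd s d y) c x.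
Proof.
move=> cd; apply/ffunP => e; rewrite !ffunE.
by case: (eqVneq e d) => // ->; rewrite eq_sym (negPf cd).
Qed.

(** The row of the R-matrix for the output bits [x], [y], applied to the amplitudes [h] of the input
    bits. With the bits known it reduces to at most two terms, so local operator identities become
    ring identities. *)
Definition R_act (t u w : C) (x y : bool) (h : bool -> bool -> C) : C :=
  match x, y with
  | false, false => (u - t * w) * h false false
  | true, true => (u - t * w) * h true true
  | false, true => t * (u - w) * h false true + (1 - t) * u * h true false
  | true, false => (u - w) * h true false + (1 - t) * w * h false true
  end.

Definition K_act (A B u : C) (x : bool) (h : bool -> C) : C :=
  if x then (u - u^-1) * h false + (B * u^-1 - A) * h true
  else (B * u - A) * h false.

Lemma R_opE t a b u w v s : a != b ->
  R_op t a b u w v s =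
  R_act t u w (s a) (s b) (fun x y => v (upd (upd s a x) b y)).
Proof.
move=> ab; rewrite ffunE.
rewrite (bigID (agree_off [set a; b] s)) /= addrC big1 ?add0r; last first.
  by move=> s' /negPf ->; rewrite mulr0 mul0r.
(* The configurations agreeing with [s] off a and b are exactly the four overwritings of [s] at
   these two sites. *)
rewrite (reindex_onto (fun q : bool * bool => upd (upd s a q.1) b q.2)
                      (fun s' => (s' a, s' b))) /=; last first.
  move=> s' /forallP h; apply/ffunP => c; rewrite !ffunE.
  case: (eqVneq c b) => [-> //|cb]; case: (eqVneq c a) => [-> //|ca].
  by have := h c; rewrite !inE (negPf cb) (negPf ca) /= => /eqP.
have -> : forall F : bool * bool -> C, \sum_(q | agree_off [set a; b] s
    (upd (upd s a q.1) b q.2) && ((upd (upd s a q.1) b q.2 a,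
    upd (upd s a q.1) b q.2 b) == q)) F q = \sum_q F q.
  move=> F; apply: eq_bigl => -[x y] /=.
  rewrite upd_same upd_other // upd_same eqxx andbT.
  apply/forallP => c; rewrite !inE; apply/implyP; rewrite negb_or => /andP[ca cb].
  by rewrite !upd_other.
have agr x y : agree_off [set a; b] s (upd (upd s a x) b y).
  apply/forallP => c; rewrite !inE; apply/implyP; rewrite negb_or => /andP[ca cb].
  by rewrite !upd_other.
under eq_bigr => q _ do
  rewrite agr mulr1 upd_same upd_other // upd_same.
rewrite -(pair_bigA _ (fun x y => R_elt t u w (s a) (s b) x y *
   v (upd (upd s a x) b y))) /= !big_bool /=.
by case: (s a); case: (s b) => /=; rewrite ?mul0r ?addr0 ?add0r // addrC.
Qed.

Lemma K_opE A B a u v s :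
  K_op A B a u v s = K_act A B u (s a) (fun x => v (upd s a x)).
Proof.
rewrite ffunE (bigID (agree_off [set a] s)) /= addrC big1 ?add0r; last first.
  by move=> s' /negPf ->; rewrite mulr0 mul0r.
have agr x : agree_off [set a] s (upd s a x).
  by apply/forallP => c; rewrite !inE; apply/implyP => ca; rewrite upd_other.
rewrite (reindex_onto (upd s a) (fun s' => s' a)) /=; last first.
  move=> s' /forallP h; apply/ffunP => c; rewrite !ffunE.
  case: (eqVneq c a) => [-> //|ca].
  by have := h c; rewrite !inE ca => /eqP.
have -> : forall F : bool -> C, \sum_(x | agree_off [set a] s
    (upd s a x) && (upd s a x a == x)) F x = \sum_x F x.
  by move=> F; apply: eq_bigl => x; rewrite agr upd_same eqxx.
under eq_bigr => q _ do rewrite agr mulr1 upd_same.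
rewrite big_bool /=.
by case: (s a) => /=; rewrite ?mul0r ?addr0 ?add0r // addrC.
Qed.

End LocalOperators.

(** * Yang-Baxter and reflection equations *)

Section LocalRelations.
Context {C : fieldType} {S : finType}.
Implicit Types (s : config S) (v : state C S).

(** By [upd3_id] every configuration has this form, which exposes the three bits that a three-space
    identity acts on and leaves eight cases to compute. *)
Definition upd3 s (a b c : S) (x y z : bool) : config S :=
  upd (upd (upd s a x) b y) c z.

Lemma upd3_id s a b c : upd3 s a b c (s a) (s b) (s c) = s.
Proof. by rewrite /upd3 !(upd_id s). Qed.

Lemma R_upd3_12 t u w a b c v s x y z : a != b -> a != c -> b != c ->
  R_op t a b u w v (upd3 s a b c x y z) =
  R_act t u w x y (fun x y => v (upd3 s a b c x y z)).
Proof.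
move=> ab ac bc; rewrite R_opE // /upd3.
rewrite (upd_other _ c a) // (upd_other _ b a) // upd_same.
rewrite (upd_other _ c b) // upd_same.
have E x' y' : upd (upd (upd (upd (upd s a x) b y) c z) a x') b y'
   = upd (upd (upd s a x') b y') c z.
  rewrite (updC _ c a) 1?eq_sym // (updC _ b a) 1?eq_sym // upd_upd.
  by rewrite (updC _ c b) 1?eq_sym // upd_upd.
by rewrite /R_act !E.
Qed.

Lemma upd3_swap s a b c x y z : a != b -> upd3 s a b c x y z = upd3 s b a c y x z.
Proof. by move=> ab; rewrite /upd3 (updC s). Qed.

Lemma upd3_rot s a b c x y z : a != b -> a != c ->
  upd3 s a b c x y z = upd3 s b c a y z x.
Proof.
move=> ab ac; rewrite /upd3 (updC s) //.
by rewrite (updC _ a c).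
Qed.

Lemma R_upd3_23 t u w a b c v s x y z : a != b -> a != c -> b != c ->
  R_op t b c u w v (upd3 s a b c x y z) =
  R_act t u w y z (fun y z => v (upd3 s a b c x y z)).
Proof.
move=> ab ac bc; rewrite upd3_rot // R_upd3_12 // 1?eq_sym //.
by rewrite /R_act !(upd3_rot s a b c).
Qed.

Lemma R_upd3_13 t u w a b c v s x y z : a != b -> a != c -> b != c ->
  R_op t a c u w v (upd3 s a b c x y z) =
  R_act t u w x z (fun x z => v (upd3 s a b c x y z)).
Proof.
move=> ab ac bc.
have E x' z' : upd3 s a b c x' y z' = upd3 s a c b x' z' y.
  by rewrite /upd3 updC.
by rewrite E R_upd3_12 // 1?eq_sym // /R_act !E.
Qed.

(** The common factor [z] lets one identity serve twice: z = 1 when c is a physical column of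
    parameter w, and z the parameter of c with w = 1 when c is an auxiliary line. *)
Lemma yang_baxter t x y z w a b c v : a != b -> a != c -> b != c ->
  R_op t a b x y (R_op t a c (x * z) w (R_op t b c (y * z) w v)) =
  R_op t b c (y * z) w (R_op t a c (x * z) w (R_op t a b x y v)).
Proof.
move=> ab ac bc; apply/ffunP => s; rewrite -(upd3_id s a b c).
by case: (s a); case: (s b); case: (s c);
  do 3!(rewrite ?R_upd3_12 ?R_upd3_13 ?R_upd3_23 //; rewrite /R_act /=); ring.
Qed.

(* The auxiliary lines c and d are crossed by a third auxiliary line e. *)
Lemma yang_baxter_aux t x y z c d e v : c != d -> c != e -> d != e ->
  R_op t c d x y (R_op t e d (z * x) 1 (R_op t e c (z * y) 1 v)) =
  R_op t e c (z * y) 1 (R_op t e d (z * x) 1 (R_op t c d x y v)).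
Proof.
move=> cd ce de; have ec : e != c by rewrite eq_sym.
have ed : e != d by rewrite eq_sym.
apply/ffunP => s; rewrite -(upd3_id s e c d).
by case: (s c); case: (s d); case: (s e);
  do 3!(rewrite ?R_upd3_12 ?R_upd3_13 ?R_upd3_23 //; rewrite /R_act /=); ring.
Qed.

Lemma R_upd2 t u w a b v s x y : a != b ->
  R_op t a b u w v (upd (upd s a x) b y) =
  R_act t u w x y (fun x y => v (upd (upd s a x) b y)).
Proof.
move=> ab; rewrite R_opE // upd_other // !upd_same.
by rewrite /R_act !(updC _ b a) 1?eq_sym // !upd_upd.
Qed.

Lemma R_upd2_21 t u w a b v s x y : a != b ->
  R_op t b a u w v (upd (upd s a x) b y) =
  R_act t u w y x (fun y x => v (upd (upd s a x) b y)).
Proof.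
move=> ab; rewrite updC // R_upd2 1?eq_sym //.
by rewrite /R_act !(updC s b a) 1?eq_sym.
Qed.

Lemma K_upd2_1 A B u a b v s x y : a != b ->
  K_op A B a u v (upd (upd s a x) b y) =
  K_act A B u x (fun x => v (upd (upd s a x) b y)).
Proof.
move=> ab; rewrite K_opE upd_other // upd_same.
by rewrite /K_act !(updC _ b a) 1?eq_sym // !upd_upd.
Qed.

Lemma K_upd2_2 A B u a b v s x y : a != b ->
  K_op A B b u v (upd (upd s a x) b y) =
  K_act A B u y (fun y => v (upd (upd s a x) b y)).
Proof. by move=> ab; rewrite K_opE upd_same /K_act !upd_upd. Qed.

(** The intertwiner enters as R_dc(x, y) and leaves as R_cd(x, y): its spaces are exchanged, its
    parameters are not. This is harmless on the vacuum, where both act as x - t y. *)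
Lemma reflection t A B x y c d v : c != d -> x != 0 -> y != 0 ->
  R_op t d c x y (K_op A B d x (R_op t c d (y * x) 1 (K_op A B c y v))) =
  K_op A B c y (R_op t d c (x * y) 1 (K_op A B d x (R_op t c d x y v))).
Proof.
move=> cd x0 y0; apply/ffunP => s.
have E : upd (upd s c (s c)) d (s d) = s by rewrite !(upd_id s).
rewrite -E.
by case: (s c); case: (s d);
  do 4!(rewrite ?R_upd2 ?R_upd2_21 ?K_upd2_1 ?K_upd2_2 //; rewrite /R_act /K_act /=);
  field; rewrite ?x0 ?y0.
Qed.

End LocalRelations.

(** * Operators on disjoint sites *)

Section Locality.
Context {C : fieldType} {S : finType}.
Implicit Types (s : config S) (v : state C S) (f g : state C S -> state C S).

(* [pin c x] is |v> -> sum_y |y>_c <x|_c |v>: it freezes the coordinate at c. *)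
Definition pin (c : S) (x : bool) v : state C S := [ffun s => v (upd s c x)].

Definition scl (a : C) v : state C S := [ffun s => a * v s].

(* A linear operator acting as the identity on the space W_c. *)
Definition off (c : S) f :=
  [/\ forall v v', f (v + v') = f v + f v',
      forall a v, f (scl a v) = scl a (f v)
    & forall x v, f (pin c x v) = pin c x (f v)].

Lemma off_comp c f g : off c f -> off c g -> off c (f \o g).
Proof.
move=> [fD fZ fp] [gD gZ gp]; split=> * /=.
- by rewrite gD fD.
- by rewrite gZ fZ.
- by rewrite gp fp.
Qed.

Lemma addsE v v' s : (v + v') s = v s + v' s.
Proof. by rewrite ffunE. Qed.

Lemma pinE c x v s : pin c x v s = v (upd s c x).
Proof. by rewrite ffunE. Qed.

Lemma sclE a v s : scl a v s = a * v s.
Proof. by rewrite ffunE. Qed.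

Lemma R_act_add t u w x y (h h' : bool -> bool -> C) :
  R_act t u w x y (fun x y => h x y + h' x y) =
  R_act t u w x y h + R_act t u w x y h'.
Proof. by case: x y => [] [] /=; ring. Qed.

Lemma R_act_scl t u w x y a (h : bool -> bool -> C) :
  R_act t u w x y (fun x y => a * h x y) = a * R_act t u w x y h.
Proof. by case: x y => [] [] /=; ring. Qed.

Lemma eq_R_act t u w x y (h h' : bool -> bool -> C) :
  (forall x y, h x y = h' x y) -> R_act t u w x y h = R_act t u w x y h'.
Proof. by move=> e; case: x y => [] [] /=; rewrite !e. Qed.

Lemma K_act_add A B u x (h h' : bool -> C) :
  K_act A B u x (fun x => h x + h' x) = K_act A B u x h + K_act A B u x h'.
Proof. by case: x => /=; ring. Qed.

Lemma K_act_scl A B u x a (h : bool -> C) :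
  K_act A B u x (fun x => a * h x) = a * K_act A B u x h.
Proof. by case: x => /=; ring. Qed.

Lemma eq_K_act A B u x (h h' : bool -> C) :
  (forall x, h x = h' x) -> K_act A B u x h = K_act A B u x h'.
Proof. by move=> e; case: x => /=; rewrite !e. Qed.

Lemma off_R t a b u w c : a != b -> c != a -> c != b -> off c (R_op t a b u w).
Proof.
move=> ab ca cb; split=> [v v'|k v|x v]; apply/ffunP => s.
- rewrite addsE !R_opE // -R_act_add.
  by apply: eq_R_act => x y; rewrite addsE.
- rewrite sclE !R_opE // -R_act_scl.
  by apply: eq_R_act => x y; rewrite sclE.
- rewrite pinE !R_opE // !upd_other 1?eq_sym //.
  apply: eq_R_act => y z; rewrite pinE (updC _ b c) 1?eq_sym //.
  by rewrite (updC _ a c) // eq_sym.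
Qed.

Lemma off_K A B a u c : c != a -> off c (K_op A B a u).
Proof.
move=> ca; split=> [v v'|k v|x v]; apply/ffunP => s.
- rewrite addsE !K_opE // -K_act_add.
  by apply: eq_K_act => x; rewrite addsE.
- rewrite sclE !K_opE // -K_act_scl.
  by apply: eq_K_act => x; rewrite sclE.
- rewrite pinE !K_opE upd_other 1?eq_sym //.
  by apply: eq_K_act => y; rewrite pinE (updC _ a c) // eq_sym.
Qed.

Lemma off_pin c x f v s : off c f -> s c = x -> f v s = f (pin c x v) s.
Proof. by move=> [_ _ ->] sc; rewrite pinE (upd_id s). Qed.

(** Since f commutes with [pin] at a and b, both sides can be evaluated with these two coordinates
    frozen. There R is a linear combination, with constant coefficients, of pinned copies of v, and
    linearity carries f through. *)
Lemma R_off_comm t a b u w f v : a != b -> off a f -> off b f ->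
  R_op t a b u w (f v) = f (R_op t a b u w v).
Proof.
move=> ab offa offb; apply/ffunP => s.
rewrite [RHS](off_pin _ (s a) _ _ s offa) // [RHS](off_pin _ (s b) _ _ s offb) //.
have [fD fZ fa] := offa; have [_ _ fb] := offb.
have fpin x y : f v (upd (upd s a x) b y) = f (pin b y (pin a x v)) s.
  by rewrite fb fa !pinE updC // eq_sym.
rewrite R_opE // (eq_R_act _ _ _ _ _ _ _ fpin).
set x := s a; set y := s b.
have pR s' : pin b y (pin a x (R_op t a b u w v)) s' =
    R_act t u w x y (fun x y => pin b y (pin a x v) s').
  rewrite !pinE updC 1?eq_sym // R_upd2 //.
  by apply: eq_R_act => x' y'; rewrite !pinE updC.
have pR' : pin b y (pin a x (R_op t a b u w v)) =
    match x, y with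
    | false, false => scl (u - t * w) (pin b false (pin a false v))
    | true, true => scl (u - t * w) (pin b true (pin a true v))
    | false, true => scl (t * (u - w)) (pin b true (pin a false v))
                     + scl ((1 - t) * u) (pin b false (pin a true v))
    | true, false => scl (u - w) (pin b false (pin a true v))
                     + scl ((1 - t) * w) (pin b true (pin a false v))
    end.
  by apply/ffunP => s'; rewrite pR; case: (x); case: (y);
    rewrite /R_act ?addsE ?sclE.
rewrite pR'.
by case: (x); case: (y) => /=; rewrite ?fD ?fZ ?addsE ?sclE.
Qed.

Lemma K_off_comm A B a u f v : off a f ->
  K_op A B a u (f v) = f (K_op A B a u v).
Proof.
move=> offa; apply/ffunP => s; rewrite [RHS](off_pin _ (s a) _ _ s offa) //.
have [fD fZ fa] := offa.
have fpin x : f v (upd s a x) = f (pin a x v) s by rewrite fa !pinE.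
rewrite K_opE (eq_K_act _ _ _ _ _ _ fpin).
have -> : pin a (s a) (K_op A B a u v) =
    if s a then scl (u - u^-1) (pin a false v) + scl (B * u^-1 - A) (pin a true v)
    else scl (B * u - A) (pin a false v).
  apply/ffunP => s'; rewrite pinE K_opE upd_same.
  by case: (s a); rewrite /K_act ?addsE ?sclE !pinE !upd_upd.
by case: (s a) => /=; rewrite ?fD ?fZ ?addsE ?sclE.
Qed.

End Locality.

(** * Exchange of auxiliary lines *)

Lemma uniq_catNr (T : eqType) (r q : seq T) a :
  uniq (r ++ q) -> a \in r -> a \notin q.
Proof.
rewrite cat_uniq => /and3P[_ /hasPn h _] ar.
by apply/negP => aq; move: (h a aq); rewrite ar.
Qed.

Lemma perm_cat_swap (T : eqType) (pre rest : seq T) a b :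
  perm_eq (pre ++ a :: b :: rest) (pre ++ b :: a :: rest).
Proof. by rewrite perm_cat2l; apply/seq.permP => q /=; rewrite addnCA. Qed.

(** Adjacent transpositions generate all permutations. The swap hypothesis is restricted to
    rearrangements of [r1], so that side conditions on the entries of [r1] remain available at each
    swap. *)
Lemma perm_swap_ind (T : eqType) (X : Type) (f : seq T -> X) (r1 r2 : seq T) :
  (forall pre a b rest, perm_eq r1 (pre ++ a :: b :: rest) ->
     f (pre ++ a :: b :: rest) = f (pre ++ b :: a :: rest)) ->
  perm_eq r1 r2 -> f r1 = f r2.
Proof.
elim: r2 r1 f => [|a r2 IH] r1 f fsw r12.
  by rewrite (perm_nilP r12).
(* The head of the target list is bubbled to the front; the tails are then compared by induction. *)
have front p1 : forall p2, perm_eq r1 (p1 ++ a :: p2) ->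
    f (p1 ++ a :: p2) = f (a :: p1 ++ p2).
  elim/last_ind: p1 => [|p1 x IHp] p2 // hp.
  move: hp; rewrite !cat_rcons => hp; rewrite fsw // IHp //.
  by rewrite (perm_trans hp) // perm_cat_swap.
have ar : a \in r1 by rewrite (perm_mem r12) inE eqxx.
case/path.splitPr: ar r12 fsw front => p1 p2 r12 fsw front.
have p12 : perm_eq (p1 ++ p2) r2.
  by rewrite -(perm_cons a) -(permPr r12) -cat1s perm_catCA.
rewrite front //; apply: (IH _ (fun r => f (a :: r))) => // pre x y rest hp.
rewrite -!cat_cons; apply: fsw.
by rewrite -cat1s perm_catCA cat1s /= perm_cons.
Qed.

Section Transfer.
Context {C : fieldType} {S : finType}.
Variables (t A B : C).
Implicit Types (U : S -> C) (s : config S) (v : state C S) (p rl : seq S).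

(* The spectral parameter attached to each site is given by U. In the lists p of
   physical sites and rl of auxiliary sites, larger indices come first. *)
Fixpoint line U (c : S) p v : state C S :=
  if p is b :: p' then R_op t c b (U c) (U b) (line U c p' v) else v.

Fixpoint cross U (c : S) rl v : state C S :=
  if rl is d :: rl' then cross U c rl' (R_op t c d (U c * U d) 1 v) else v.

Definition transfer U c p rl v := line U c p (cross U c rl (K_op A B c (U c) v)).

Fixpoint tot U p rl v : state C S :=
  if rl is c :: rl' then tot U p rl' (transfer U c p rl' v) else v.

Lemma off_line U c p e : c \notin p -> e != c -> e \notin p -> off e (line U c p).
Proof.
move=> + ec; elim: p => [|b p IH] //=.
rewrite !inE !negb_or => /andP[cb cp] /andP[eb ep].
by apply: (off_comp _ (R_op t c b (U c) (U b))); [exact: off_R | exact: IH].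
Qed.

Lemma off_cross U c rl e : c \notin rl -> e != c -> e \notin rl -> off e (cross U c rl).
Proof.
move=> + ec; elim: rl => [|b p IH] //=.
rewrite !inE !negb_or => /andP[cb cp] /andP[eb ep].
by apply: (off_comp _ _ (R_op t c b (U c * U b) 1)); [exact: IH | exact: off_R].
Qed.

Lemma off_transfer U c p rl e : c \notin p -> c \notin rl -> e != c ->
  e \notin p -> e \notin rl -> off e (transfer U c p rl).
Proof.
move=> cp crl ec ep erl.
apply: (off_comp _ (line U c p)); first exact: off_line.
by apply: (off_comp _ (cross U c rl)); [exact: off_cross | exact: off_K].
Qed.

Lemma off_tot U p rl e : uniq (rl ++ p) -> e \notin p -> e \notin rl ->
  off e (tot U p rl).
Proof.
move=> + ep; elim: rl => [|c rl IH] /=; first by move=> *; split.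
rewrite mem_cat negb_or inE negb_or => /andP[/andP[cr cp] un] /andP[ec er].
apply: (off_comp _ (tot U p rl)); first exact: IH.
exact: off_transfer.
Qed.

Lemma cross_off_comm U c rl f v : c \notin rl -> {in c :: rl, forall b, off b f} ->
  cross U c rl (f v) = f (cross U c rl v).
Proof.
elim: rl v => [|b p IH] v //=; rewrite inE negb_or => /andP[cb cp] offf.
rewrite R_off_comm //; try by apply: offf; rewrite !inE eqxx ?orbT.
rewrite IH // => e.
by rewrite inE => h; apply: offf; rewrite !inE orbCA h orbT.
Qed.

Lemma line_swap U c d p v : c != d -> c \notin p -> d \notin p -> uniq p ->
  R_op t d c (U d) (U c) (line U d p (line U c p v)) =
  line U c p (line U d p (R_op t d c (U d) (U c) v)).
Proof.
move=> cd; have dc : d != c by rewrite eq_sym.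
elim: p v => [|b p IH] v //=; rewrite !inE !negb_or.
move=> /andP[cb cp] /andP[db dp] /andP[bp up].
have bc : b != c by rewrite eq_sym.
have bd : b != d by rewrite eq_sym.
rewrite -(R_off_comm _ _ _ _ _ (line U d p)) //; try exact: off_line.
have := yang_baxter t (U d) (U c) 1 (U b) d c b (line U d p (line U c p v)).
rewrite !mulr1 => -> //.
by rewrite IH // (R_off_comm _ _ _ _ _ (line U c p)) //; exact: off_line.
Qed.

Lemma cross_swap_lines U c d rl v : c != d -> c \notin rl -> d \notin rl -> uniq rl ->
  R_op t d c (U d) (U c) (cross U d rl (cross U c rl v)) =
  cross U c rl (cross U d rl (R_op t d c (U d) (U c) v)).
Proof.
move=> cd; have dc : d != c by rewrite eq_sym.
elim: rl v => [|b p IH] v //=; rewrite !inE !negb_or.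
move=> /andP[cb cp] /andP[db dp] /andP[bp up].
have bc : b != c by rewrite eq_sym.
have bd : b != d by rewrite eq_sym.
rewrite (R_off_comm _ _ _ _ _ (cross U c p)) //; try exact: off_cross.
rewrite IH // yang_baxter //.
by rewrite -(R_off_comm _ _ _ _ _ (cross U d p)) //; exact: off_cross.
Qed.

Lemma transfer_swap U c d p rl v : c != d -> U c != 0 -> U d != 0 ->
  uniq (c :: d :: rl ++ p) ->
  R_op t d c (U d) (U c) (transfer U d p rl (transfer U c p (d :: rl) v)) =
  transfer U c p rl (transfer U d p (c :: rl) (R_op t c d (U d) (U c) v)).
Proof.
move=> cd c0 d0; rewrite /= cat_uniq !inE !mem_cat !negb_or.
move=> /and3P[/and3P[_ cr cp] /andP[dr dp] /and3P[ur hp up]].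
have dc : d != c by rewrite eq_sym.
have pr b : b \in p -> b \notin rl.
  by move=> bp; apply/negP => br; case/hasP: hp; exists b.
rewrite /transfer /=.
(* Operators on disjoint spaces are sorted so that the column parts stand leftmost, then the
   crossings with [rl], then a core on c and d alone. The intertwiner passes these three blocks in
   turn, the last one by the reflection equation. *)
rewrite !(K_off_comm _ _ _ _ (line U _ p)) //; try exact: off_line.
rewrite !(K_off_comm _ _ _ _ (cross U _ rl)) //; try exact: off_cross.
have XL e f v' : e \notin rl -> e \notin p -> f \notin p -> f \notin rl -> e != f ->
    cross U e rl (line U f p v') = line U f p (cross U e rl v').
  move=> er ep fp fr ef; apply: cross_off_comm => // b; rewrite inE => /orP[/eqP ->|br].
    exact: off_line.
  apply: off_line => //; first by apply: contraNneq fr => <-.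
  by apply: contraL br => /pr.
rewrite !XL // line_swap // cross_swap_lines //.
by rewrite reflection.
Qed.

Lemma cross_swap U e c d pre rl v : uniq (e :: pre ++ c :: d :: rl) ->
  R_op t c d (U d) (U c) (cross U e (pre ++ c :: d :: rl) v) =
  cross U e (pre ++ d :: c :: rl) (R_op t c d (U d) (U c) v).
Proof.
elim: pre v => [|b pre IH] v /=.
  rewrite !inE !negb_or => /and4P[/and3P[ec ed er] /andP[cd cr] dr ur].
  rewrite (R_off_comm _ _ _ _ _ (cross U e rl)) //; try exact: off_cross.
    by rewrite yang_baxter_aux // eq_sym.
  by apply: off_cross => //; rewrite eq_sym.
  by apply: off_cross => //; rewrite eq_sym.
rewrite inE negb_or => /andP[/andP[eb ep] /andP[bp un]].
rewrite IH /= ?ep // (R_off_comm _ _ _ _ _ (R_op t e b _ _)) //.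
- move: un; rewrite cat_uniq /= => /and3P[_ _ /andP[+ _]].
  by rewrite inE negb_or => /andP[].
- move: ep bp; rewrite !mem_cat !inE !negb_or => /and4P[_ ec ed _] /and4P[_ bc bd _].
  by apply: off_R => //; rewrite eq_sym.
- move: ep bp; rewrite !mem_cat !inE !negb_or => /and4P[_ ec ed _] /and4P[_ bc bd _].
  by apply: off_R => //; rewrite eq_sym.
Qed.

(** The lines in [rl] act after c and d and do not touch these two spaces. Those in [pre] act before
    and cross both, so the intertwiner also has to be pulled through each of them. *)
Lemma tot_swap U c d p pre rl v : U c != 0 -> U d != 0 ->
  uniq ((pre ++ c :: d :: rl) ++ p) ->
  R_op t d c (U d) (U c) (tot U p (pre ++ c :: d :: rl) v) =
  tot U p (pre ++ d :: c :: rl) (R_op t c d (U d) (U c) v).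
Proof.
move=> c0 d0; elim: pre v => [|e pre IH] v.
  rewrite cat0s /= => un.
  move: (un); rewrite inE negb_or => /and3P[/andP[cd]].
  rewrite !mem_cat !negb_or => /andP[cr cp] /andP[dr dp] urp.
  rewrite (R_off_comm _ _ _ _ _ (tot U p rl)) 1?eq_sym //; try exact: off_tot.
  by rewrite transfer_swap.
move=> /= /andP[he un]; rewrite IH //; congr (tot _ _ _ _).
rewrite /transfer.
move: (he); rewrite !mem_cat !inE !negb_or.
move=> /andP[/and4P[epr ec ed er] ep].
have cp : c \notin p by apply: (uniq_catNr _ _ _ _ un); rewrite mem_cat inE eqxx orbT.
have dp : d \notin p by apply: (uniq_catNr _ _ _ _ un); rewrite mem_cat !inE eqxx !orbT.
have cd : c != d.
  move: un; rewrite -catA cat_uniq /= => /and4P[_ _ + _].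
  by rewrite inE negb_or => /andP[].
have ce : c != e by rewrite eq_sym.
have de : d != e by rewrite eq_sym.
rewrite (R_off_comm _ _ _ _ _ (line U e p)) //; try exact: off_line.
rewrite cross_swap /=.
  by rewrite (R_off_comm _ _ _ _ _ (K_op _ _ _ _)) //; exact: off_K.
move: un; rewrite cat_uniq => /andP[-> _].
by move: he; rewrite mem_cat negb_or => /andP[->].
Qed.

Definition amp U p rl : state C S := tot U p rl (ket C [ffun=> false]).

Lemma ket0_eq0 (s : config S) a : s a -> ket C [ffun=> false] s = 0.
Proof. by move=> sa; rewrite ffunE; case: eqP => // e; move: sa; rewrite e ffunE. Qed.

Lemma R_ket0 a b x y : a != b ->
  R_op t a b x y (ket C [ffun=> false]) = scl (x - t * y) (ket C [ffun=> false] : state C S).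
Proof.
move=> ab; apply/ffunP => s; rewrite R_opE // sclE.
pose h i j : C := ket C [ffun=> false] (upd (upd s a i) b j).
rewrite -[R_act _ _ _ _ _ _]/(R_act t x y (s a) (s b) h).
have h0 i j : i || j -> h i j = 0.
  case: i => /= [|jt]; first by move=> _; apply: (ket0_eq0 _ a); rewrite upd_other // upd_same.
  by apply: (ket0_eq0 _ b); rewrite upd_same.
have -> : ket C [ffun=> false] s = h (s a) (s b) by rewrite /h !(upd_id s).
have h01 := h0 false true isT; have h10 := h0 true false isT.
have h11 := h0 true true isT.
by case: (s a); case: (s b); rewrite /R_act ?h01 ?h10 ?h11 ?mulr0 ?addr0.
Qed.

Definition zero_on (r : seq S) s := {in r, forall c, s c = false}.

Lemma R_diag a b x y v s : a != b -> s a = false -> s b = false ->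
  R_op t a b x y v s = (x - t * y) * v s.
Proof. by move=> ab sa sb; rewrite R_opE // sa sb /R_act !(upd_id s). Qed.

Lemma op_of_scl (M : config S -> config S -> C) k v :
  op_of M (scl k v) = scl k (op_of M v).
Proof.
apply/ffunP => s; rewrite !ffunE mulr_sumr; apply: eq_bigr => s' _.
by rewrite ffunE mulrCA.
Qed.

Lemma tot_scl U p rl k v : tot U p rl (scl k v) = scl k (tot U p rl v).
Proof.
have lineZ c v' : line U c p (scl k v') = scl k (line U c p v').
  by elim: p => //= b p' ->; exact: op_of_scl.
have crossZ c r v' : cross U c r (scl k v') = scl k (cross U c r v').
  by elim: r v' => //= b p' IH v'; rewrite [R_op _ _ _ _ _ _]op_of_scl.
elim: rl v => //= c rl IH v.
by rewrite /transfer [K_op _ _ _ _ _]op_of_scl crossZ lineZ.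
Qed.

Lemma amp_swap U c d p pre rl s : U c != 0 -> U d != 0 -> U d != t * U c ->
  uniq ((pre ++ c :: d :: rl) ++ p) -> s c = false -> s d = false ->
  amp U p (pre ++ c :: d :: rl) s = amp U p (pre ++ d :: c :: rl) s.
Proof.
move=> c0 d0 dtc un sc sd.
have cd : c != d.
  move: un; rewrite -catA cat_uniq /= => /and4P[_ _ + _].
  by rewrite inE negb_or => /andP[].
have := congr1 (fun v : state C S => v s)
  (tot_swap U c d p pre rl (ket C [ffun=> false]) c0 d0 un).
rewrite /= R_diag 1?eq_sym // R_ket0 //.
by rewrite tot_scl sclE; apply: mulfI; rewrite subr_eq0.
Qed.

Lemma amp_perm U p rl1 rl2 s : {in rl1, forall c, U c != 0} ->
  {in rl1 &, forall c d, c != d -> U d != t * U c} ->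
  uniq (rl1 ++ p) -> zero_on rl1 s -> perm_eq rl1 rl2 ->
  amp U p rl1 s = amp U p rl2 s.
Proof.
move=> U0 Ut un z; apply: (perm_swap_ind _ _ (fun r => amp U p r s)).
move=> pre c d rest hp.
have cin : c \in rl1 by rewrite (perm_mem hp) mem_cat inE eqxx orbT.
have din : d \in rl1 by rewrite (perm_mem hp) mem_cat !inE eqxx !orbT.
have un' : uniq ((pre ++ c :: d :: rest) ++ p).
  by rewrite -(perm_uniq (s1 := rl1 ++ p)) // perm_cat2r.
apply: amp_swap; rewrite ?U0 ?z //.
apply: Ut => //.
move: un'; rewrite -catA cat_uniq /= => /and4P[_ _ + _].
by rewrite inE negb_or => /andP[].
Qed.

End Transfer.

(** * Removal of the last column *)

Section Recursion.
Context {C : fieldType} {S : finType}.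
Variables (t A B : C).
Implicit Types (U : S -> C) (s : config S) (v : state C S) (p rl : seq S).
Local Notation line := (line t).
Local Notation cross := (cross t).
Local Notation transfer := (transfer t A B).
Local Notation tot := (tot t A B).
Local Notation amp := (amp t A B).

Fixpoint col U (b : S) rl v : state C S :=
  if rl is c :: rl' then col U b rl' (R_op t c b (U c) (U b) v) else v.

(** On each line the vertex at b acts last, and it shares no space with the remaining columns of the
    lines that act later. Hence the whole last column can be moved after all other vertices. *)
Lemma tot_col U b p rl v : uniq (rl ++ b :: p) ->
  tot U (b :: p) rl v = col U b rl (tot U p rl v).
Proof.
elim: rl v => [|c rl IH] v //=; rewrite mem_cat inE !negb_or.
move=> /andP[/and3P[cr cb cp] un]; rewrite IH //; congr (col _ _ _ _).
have br : b \notin rl.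
  by apply/negP => /(uniq_catNr _ _ _ _ un); rewrite inE eqxx.
have bp : b \notin p by move: un; rewrite cat_uniq => /and3P[_ _ /andP[]].
have un' : uniq (rl ++ p).
  apply: subseq_uniq un; apply: cat_subseq => //; exact: subseq_cons.
by rewrite (R_off_comm _ _ _ _ _ (tot U p rl)) //; exact: off_tot.
Qed.

Lemma col_false U b rl v s : zero_on rl s -> s b = false -> b \notin rl ->
  col U b rl v s = \prod_(c <- rl) (U c - t * U b) * v s.
Proof.
move=> + sb; elim: rl v => [|c rl IH] v z; first by rewrite big_nil mul1r.
rewrite inE negb_or => /andP[bc br] /=; rewrite IH //; last first.
  by move=> d dr; apply: z; rewrite inE dr orbT.
rewrite R_diag 1?eq_sym // ?big_cons; first by ring.
by apply: z; rewrite inE eqxx.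
Qed.

(* The column sum over the line l that raises the site b, where y is the
   parameter of b and h l the amplitude of the other columns with line l ending
   in state 1. *)
Fixpoint colsum U (y : C) (h : S -> C) rl : C :=
  if rl is c :: rl' then
    \prod_(d <- rl') (t * (U d - y)) * ((1 - t) * U c * h c)
    + (U c - t * y) * colsum U y h rl'
  else 0.

Lemma colsum_scl U y h h' k rl : {in rl, forall c, h' c = k * h c} ->
  colsum U y h' rl = k * colsum U y h rl.
Proof.
elim: rl => [|c rl IH] hh /=; first by rewrite mulr0.
rewrite IH ?hh ?inE ?eqxx //; first by ring.
by move=> d dr; rewrite hh // inE dr orbT.
Qed.

Lemma col_true U b rl v s : zero_on rl s -> s b = true -> b \notin rl -> uniq rl ->
  col U b rl v s = \prod_(c <- rl) (t * (U c - U b)) * v s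
    + colsum U (U b) (fun c => v (upd (upd s c true) b false)) rl.
Proof.
move=> + sb; elim: rl v => [|c rl IH] v z /=; first by rewrite big_nil mul1r addr0.
rewrite inE negb_or => /andP[bc br] /andP[cr ur].
have sc : s c = false by apply: z; rewrite inE eqxx.
have z' : zero_on rl s by move=> d dr; apply: z; rewrite inE dr orbT.
have cb : c != b by rewrite eq_sym.
rewrite IH // (colsum_scl U (U b) (fun c => v (upd (upd s c true) b false)) _ (U c - t * U b)).
  by rewrite R_opE // sc sb /R_act (upd_id s c false) // (upd_id s b true) // big_cons; ring.
move=> d dr; apply: R_diag => //; last by rewrite upd_same.
rewrite upd_other // upd_other //; by apply: contraNneq cr => ->.
Qed.

Definition vac (d : S) v : Prop := forall s, s d -> v s = 0.

Lemma vac_off d f v : off d f -> vac d v -> vac d (f v).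
Proof.
move=> offf vv s sd; rewrite (off_pin _ true _ _ s offf) //.
have [_ fZ _] := offf.
(* Zero is written as a multiple of v, so that the scalar clause of [off] yields the vanishing of
   its image. *)
have -> : pin d true v = scl 0 v.
  by apply/ffunP => s'; rewrite pinE sclE mul0r vv // upd_same.
by rewrite fZ sclE mul0r.
Qed.

Lemma scl_scl a a' v : scl a (scl a' v) = scl (a * a') v.
Proof. by apply/ffunP => s; rewrite !sclE mulrA. Qed.

Lemma scl1 v : scl 1 v = v.
Proof. by apply/ffunP => s; rewrite sclE mul1r. Qed.

Lemma K_pin_true c u v : vac c v ->
  pin c true (K_op A B c u v) = scl (u - u^-1) (pin c false v).
Proof.
move=> vv; apply/ffunP => s; rewrite pinE sclE K_opE upd_same /K_act pinE !upd_upd.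
by rewrite (vv (upd s c true)) ?upd_same // mulr0 addr0.
Qed.

(** R conserves the number of 1s. If d enters with 0, a 1 leaving along c must have entered along c,
    with weight [10|10]; when d is read as 1, both sides vanish. *)
Lemma R_pin_true c d x y v : c != d -> vac d v ->
  pin c true (R_op t c d x y v) = scl (x - y) (pin c true v).
Proof.
move=> cd vv; apply/ffunP => s; rewrite pinE sclE pinE.
have E z z' : upd (upd (upd s c true) c z) d z' = upd (upd s c z) d z'.
  by rewrite upd_upd.
rewrite R_opE // upd_same upd_other 1?eq_sym // /R_act !E.
have [sd|/negbTE sd] := boolP (s d).
  rewrite (vv (upd _ d true)) ?upd_same // (vv (upd s c true)) ?mulr0 //.
  by rewrite upd_other 1?eq_sym.
rewrite (vv (upd _ d true)) ?upd_same // mulr0 addr0 (upd_id (upd s c true)) //.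
by rewrite upd_other 1?eq_sym.
Qed.

Lemma cross_pin_true U c rl v : c \notin rl -> uniq rl -> {in rl, forall d, vac d v} ->
  pin c true (cross U c rl v) = scl (\prod_(d <- rl) (U c * U d - 1)) (pin c true v).
Proof.
elim: rl v => [|d rl IH] v /=; first by rewrite big_nil scl1.
rewrite inE negb_or => /andP[cd cr] /andP[dr ur] vv.
rewrite IH // ?R_pin_true // ?scl_scl ?big_cons 1?mulrC //.
  by apply: vv; rewrite inE eqxx.
move=> e er; apply: vac_off; last by apply: vv; rewrite inE er orbT.
by apply: off_R => //; [apply: contraNneq cr | apply: contraNneq dr] => <-.
Qed.

Lemma line_pin_true U c p v : c \notin p -> uniq p -> {in p, forall d, vac d v} ->
  pin c true (line U c p v) = scl (\prod_(b <- p) (U c - U b)) (pin c true v).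
Proof.
elim: p => [|b p IH] /=; first by rewrite big_nil scl1.
rewrite inE negb_or => /andP[cb cp] /andP[bp up] vv.
rewrite R_pin_true // ?IH // ?scl_scl ?big_cons //.
  by move=> d dp; apply: vv; rewrite inE dp orbT.
apply: vac_off; last by apply: vv; rewrite inE eqxx.
by apply: off_line; rewrite 1?eq_sym.
Qed.

(** The weight of a line that turns from 0 to 1 at its K-matrix and stays 1 through all crossings
    and columns, every other space being in the vacuum. *)
Definition frozen_weight U c p rl : C := (U c - (U c)^-1) *
  \prod_(d <- rl) (U c * U d - 1) * \prod_(b <- p) (U c - U b).

Lemma transfer_pin_true U c p rl v : uniq (c :: rl ++ p) ->
  {in c :: rl ++ p, forall d, vac d v} ->
  pin c true (transfer U c p rl v) = scl (frozen_weight U c p rl) (pin c false v).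
Proof.
rewrite /= mem_cat negb_or => /andP[/andP[cr cp] un] vv.
have := un; rewrite cat_uniq => /and3P[ur _ up].
have vK d : d \in rl ++ p -> vac d (K_op A B c (U c) v).
  move=> dr; apply: vac_off; last by apply: vv; rewrite inE dr orbT.
  apply: off_K; apply: contraTneq dr => ->.
  by rewrite mem_cat negb_or cr cp.
rewrite /transfer line_pin_true // ?cross_pin_true // ?K_pin_true // ?scl_scl.
- by rewrite /frozen_weight; congr scl; ring.
- by apply: vv; rewrite inE eqxx.
- by move=> d dr; apply: vK; rewrite mem_cat dr.
move=> b bp; apply: vac_off; last by apply: vK; rewrite mem_cat bp orbT.
apply: off_cross => //; first by apply: contraNneq cp => <-.
by apply/negP => br; move: (uniq_catNr _ _ _ _ un br); rewrite bp.
Qed.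

Lemma vac_ket0 d : vac d (ket C [ffun=> false]).
Proof. by move=> s; apply: ket0_eq0. Qed.

Lemma amp_head_true U c p rl s : uniq (c :: rl ++ p) -> s c = true ->
  amp U p (c :: rl) s = frozen_weight U c p rl * amp U p rl (upd s c false).
Proof.
move=> un sc; have := un; rewrite /= mem_cat negb_or => /andP[/andP[cr cp] un'].
have offc := off_tot t A B U p rl c un' cp cr.
have [_ fZ fp] := offc.
rewrite /amp /= (off_pin _ true _ _ s offc) //.
rewrite transfer_pin_true //; last by move=> d _; apply: vac_ket0.
by rewrite fZ sclE fp pinE.
Qed.

Lemma vac_amp U b p rl : uniq (rl ++ b :: p) -> vac b (amp U p rl).
Proof.
move=> un; apply: vac_off; last exact: vac_ket0.
have br : b \notin rl.
  by apply/negP => /(uniq_catNr _ _ _ _ un); rewrite inE eqxx.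
have bp : b \notin p by move: un; rewrite cat_uniq => /and3P[_ _ /andP[]].
apply: off_tot => //.
apply: subseq_uniq un; apply: cat_subseq => //; exact: subseq_cons.
Qed.

Lemma amp_false U b p rl s : uniq (rl ++ b :: p) -> zero_on rl s -> s b = false ->
  amp U (b :: p) rl s = \prod_(c <- rl) (U c - t * U b) * amp U p rl s.
Proof.
move=> un z sb; rewrite /amp tot_col // col_false //.
by apply/negP => /(uniq_catNr _ _ _ _ un); rewrite inE eqxx.
Qed.

Lemma amp_true U b p rl s : uniq (rl ++ b :: p) -> zero_on rl s -> s b = true ->
  amp U (b :: p) rl s =
  colsum U (U b) (fun c => amp U p rl (upd (upd s c true) b false)) rl.
Proof.
move=> un z sb; rewrite {1}/amp tot_col // col_true //.
- by rewrite (vac_amp U b p rl un s) // mulr0 add0r.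
- by apply/negP => /(uniq_catNr _ _ _ _ un); rewrite inE eqxx.
- by move: un; rewrite cat_uniq => /andP[].
Qed.

End Recursion.

(** * Lagrange interpolation in the parameter of the last column *)

Section Interpolation.
Context {C : fieldType} {S : finType}.
Variables (t A B : C).
Implicit Types (U : S -> C) (s : config S) (v : state C S) (p rl : seq S).
Local Notation amp := (amp t A B).
Local Notation colsum := (colsum t).

Lemma eq_tot U V p rl v : {in rl ++ p, U =1 V} -> tot t A B U p rl v = tot t A B V p rl v.
Proof.
have eq_line c q v' : U c = V c -> {in q, U =1 V} -> line t U c q v' = line t V c q v'.
  move=> e; elim: q => //= b q IH h; rewrite e h ?inE ?eqxx // IH // => d dq.
  by apply: h; rewrite inE dq orbT.
have eq_cross c q v' : U c = V c -> {in q, U =1 V} -> cross t U c q v' = cross t V c q v'.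
  move=> e; elim: q v' => //= b q IH v' h; rewrite e h ?inE ?eqxx // IH // => d dq.
  by apply: h; rewrite inE dq orbT.
elim: rl v => //= c rl IH v h; rewrite IH; last by move=> d dr; rewrite h // inE dr orbT.
congr (tot _ _ _ _ _ _ _); have e : U c = V c by rewrite h // inE eqxx.
rewrite /transfer e eq_cross //; first apply: eq_line => // d dr.
  by rewrite h // inE mem_cat dr !orbT.
by move=> d dr; rewrite h // inE mem_cat dr !orbT.
Qed.

Lemma eq_colsum U V y y' h h' rl : y = y' -> {in rl, U =1 V} -> {in rl, h =1 h'} ->
  colsum U y h rl = colsum V y' h' rl.
Proof.
move=> <-; elim: rl => //= c rl IH UV hh.
have UV' : {in rl, U =1 V} by move=> d dr; rewrite UV // inE dr orbT.
rewrite IH // ?UV ?hh ?inE ?eqxx //; last by move=> d dr; rewrite hh // inE dr orbT.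
by congr (_ * _ + _); apply: eq_big_seq => d dr; rewrite UV'.
Qed.

Lemma size_affine_le (a b : C) : (size (a%:P - b *: 'X)%R <= 2)%N.
Proof.
rewrite (leq_trans (size_polyD _ _)) // geq_max size_polyN (leq_trans (size_polyC_leq1 _)) //.
by rewrite (leq_trans (size_scale_leq _ _)) // size_polyX.
Qed.

Lemma size_mul_affine_le (p q : {poly C}) n :
  (size p <= 2)%N -> (size q <= n)%N -> (size (p * q)%R <= n.+1)%N.
Proof.
move=> sp sq; rewrite (leq_trans (size_polyMleq _ _)) //.
by rewrite -subn1 leq_subLR (leq_add sp sq).
Qed.

Lemma size_prod_affine_le (T : Type) (r : seq T) (f : T -> {poly C}) :
  (forall i, (size (f i) <= 2)%N) -> (size (\prod_(i <- r) f i)%R <= (size r).+1)%N.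
Proof.
move=> hf; elim: r => [|i r IH]; first by rewrite big_nil size_poly1.
by rewrite big_cons size_mul_affine_le.
Qed.

(** In each term the raising line has a weight free of y and every other line an affine one, so the
    degree is smaller than the number of lines. *)
Lemma colsum_poly U h rl : exists2 q : {poly C}, (size q <= size rl)%N &
  forall y, q.[y] = colsum U y h rl.
Proof.
elim: rl => [|c rl [q sq hq]] /=.
  by exists 0; rewrite ?size_poly0 // => y; rewrite horner0.
exists (((1 - t) * U c * h c) *: \prod_(d <- rl) ((t * U d)%:P - t *: 'X)
        + ((U c)%:P - t *: 'X) * q).
- rewrite (leq_trans (size_polyD _ _)) // geq_max; apply/andP; split.
    rewrite (leq_trans (size_scale_leq _ _)) // size_prod_affine_le // => d.
    exact: size_affine_le.
  by rewrite size_mul_affine_le // size_affine_le.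
- move=> y; rewrite hornerD hornerZ hornerM horner_prod hq.
  under eq_bigr => d _ do rewrite !hornerE -mulrBr.
  by rewrite hornerD hornerN hornerC hornerZ hornerX; ring.
Qed.

(** The interpolation term of the line of parameter u: the quotients (d - t w) / (d - u) form the
    Lagrange basis polynomial at the node u / t. The factor u^2 - 1 is u from the raising vertex
    times u - 1/u from the K-matrix. *)
Definition column_weight (us : seq C) (u w : C) (ws : seq C) : C :=
  (1 - t) * (u ^+ 2 - 1) * \prod_(z <- ws) (u - z) *
  \prod_(d <- us) ((t * d - u) / (d - u) * (d * u - 1) * (d - t * w)).

Lemma map_rem_in (T1 T2 : eqType) (f : T1 -> T2) (x : T1) (r : seq T1) :
  x \in r -> {in r &, injective f} -> map f (rem x r) = rem (f x) (map f r).
Proof.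
elim: r => //= y r IH; rewrite inE => xr finj.
rewrite (inj_in_eq finj) ?inE ?eqxx //.
have [//|yx] := eqVneq y x; rewrite /= IH //.
  by move: xr; rewrite eq_sym (negbTE yx).
by move=> a b ar br; apply: finj; rewrite inE ?ar ?br orbT.
Qed.

Lemma amp_true_sum U b p rl s : t != 0 -> {in rl, forall c, U c != 0} ->
  {in rl &, forall c d, c != d -> U d != t * U c} -> {in rl &, injective U} ->
  uniq (rl ++ b :: p) -> zero_on rl s -> s b = true ->
  amp U (b :: p) rl s =
  \sum_(l <- rl) column_weight (map U (rem l rl)) (U l) (U b) (map U p)
                 * amp U p (rem l rl) (upd s b false).
Proof.
move=> t0 U0 Ut Uinj un z sb.
have br : b \notin rl.
  by apply/negP => /(uniq_catNr _ _ _ _ un); rewrite inE eqxx.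
have bp : b \notin p by move: un; rewrite cat_uniq => /and3P[_ _ /andP[]].
have url : uniq rl by move: un; rewrite cat_uniq => /andP[].
have unp : uniq (rl ++ p).
  apply: subseq_uniq un; apply: cat_subseq => //; exact: subseq_cons.
pose h r c := amp U p r (upd (upd s c true) b false).
have [q sq hq] := colsum_poly U (h rl) rl.
(* The expected value at the node U l / t, divided by the value there of the product over the other
   lines d of U d - t y. *)
pose coef l := (1 - t) * (U l ^+ 2 - 1) * \prod_(z <- map U p) (U l - z) *
  \prod_(d <- rem l rl) ((t * U d - U l) / (U d - U l) * (U d * U l - 1)) *
  amp U p (rem l rl) (upd s b false).
pose q' := \sum_(l <- rl) coef l *: \prod_(d <- rem l rl) ((U d)%:P - t *: 'X).
have hq' y : q'.[y] = \sum_(l <- rl) coef l * \prod_(d <- rem l rl) (U d - t * y).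
  rewrite horner_sum; apply: eq_bigr => l _; rewrite hornerZ horner_prod.
  by congr (_ * _); apply: eq_bigr => d _; rewrite !hornerE.
have sq' : (size q' <= size rl)%N.
  rewrite /q' big_seq; apply: (leq_trans (size_sum _ _ _)).
  apply/bigmax_leqP_seq => l lr _; rewrite (leq_trans (size_scale_leq _ _)) //.
  have := size_prod_affine_le S (rem l rl) (fun d => (U d)%:P - t *: 'X).
  rewrite size_rem // prednK; last by case: (rl) lr.
  by apply=> d; exact: size_affine_le.
have qq' : q = q'.
  apply/eqP; rewrite -subr_eq0; apply/eqP.
  apply: (roots_geq_poly_eq0 (rs := [seq U l / t | l <- rl])).
  - apply/allP => _ /mapP[l lr ->]; rewrite /root !hornerE subr_eq0 hq hq'; apply/eqP.
    have ty : t * (U l / t) = U l by rewrite mulrCA mulfV // mulr1.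
    set y := U l / t in ty *.
    pose r := rem l rl.
    have prl : perm_eq rl (l :: r) := perm_to_rem lr.
    have unl : uniq ((l :: r) ++ b :: p).
      by rewrite -(perm_uniq (s1 := rl ++ b :: p)) // perm_cat2r.
    have unlp : uniq ((l :: r) ++ p).
      by rewrite -(perm_uniq (s1 := rl ++ p)) // perm_cat2r.
    have bl : l != b by apply: contraNneq br => <-.
    have sl : s l = false by apply: z.
    have lr' : l \notin r by move: unl => /= /andP[]; rewrite mem_cat negb_or => /andP[].
    (* To use the exchange symmetry, the value of the polynomial at the node is read as a genuine
       amplitude whose last column has parameter y. The symmetry does not apply to the terms
       [h rl c] themselves, where line c ends in state 1. *)
    pose V c := if c == b then y else U c.
    have Vb : V b = y by rewrite /V eqxx.
    have VU c : c \in rl ++ p -> V c = U c.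
      rewrite /V; case: eqVneq => // ->.
      by rewrite mem_cat (negbTE br) (negbTE bp).
    have VUr c : c \in rl -> V c = U c by move=> cr; apply: VU; rewrite mem_cat cr.
    have ampV r' : perm_eq rl r' -> uniq (r' ++ b :: p) -> zero_on r' s ->
        amp V (b :: p) r' s = colsum U y (h r') r'.
      move=> prr' un' z'; rewrite amp_true // Vb; apply: eq_colsum => // c cr'.
        by rewrite VUr // (perm_mem prr').
      rewrite /h /amp (eq_tot V U) // => d; rewrite mem_cat -(perm_mem prr') -mem_cat.
      exact: VU.
    have zl : zero_on (l :: r) s by move=> c; rewrite -(perm_mem prl); exact: z.
    rewrite -ampV // (amp_perm _ _ _ _ _ rl (l :: r)) //; first last.
    - by move=> c d cr dr; rewrite !VUr //; exact: Ut.
    - by move=> c cr; rewrite VUr // U0.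
    (* With l at the head, the factor U l - t y = 0 kills every term in which another line raises
       b. *)
    rewrite ampV // [LHS]/= -/y ty subrr mul0r addr0 /h amp_head_true //; last first.
      by rewrite upd_other // upd_same.
    rewrite (updC _ b l) 1?eq_sym // upd_upd.
    rewrite (upd_id s l false) //.
    (* For l' different from l, the list without l' still contains l, whose factor vanishes at this
       node. *)
    rewrite [in RHS](bigD1_seq l) //= [X in _ = _ + X]big1_seq ?addr0; last first.
      move=> l' /andP[l'l l'r].
      have -> : \prod_(d <- rem l' rl) (U d - U l) = 0; last by rewrite mulr0.
      rewrite (big_rem l) /=; first by rewrite subrr mul0r.
      by rewrite mem_rem_uniq // inE eq_sym l'l.
    rewrite /coef -/r /frozen_weight big_map.
    have -> : \prod_(d <- r) (t * (U d - y)) = \prod_(d <- r) (t * U d - U l).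
      by apply: eq_bigr => d _; rewrite mulrBr ty.
    have E : \prod_(d <- r) ((t * U d - U l) / (U d - U l) * (U d * U l - 1)) *
       \prod_(d <- r) (U d - U l) = \prod_(d <- r) (t * U d - U l) *
       \prod_(d <- r) (U l * U d - 1).
      rewrite -!big_split; apply: eq_big_seq => d dr /=.
      have dl : U d - U l != 0.
        rewrite subr_eq0; apply: contraNneq lr' => /Uinj <- //.
        by rewrite (perm_mem prl) inE dr orbT.
      by field.
    set Q1 := \prod_(d <- r) _ in E *; set Q2 := \prod_(d <- r) _ in E *.
    set P1 := \prod_(d <- r) _ in E *; set P2 := \prod_(d <- r) _ in E *.
    set P3 := \prod_(b <- p) _; set a := amp U p r _.
    transitivity ((1 - t) * (U l ^+ 2 - 1) * P3 * a * (Q1 * Q2)); last by ring.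
    by rewrite E; field; exact: U0.
  - rewrite map_inj_in_uniq // => c d cr dr /(mulIf _) e.
    by apply: Uinj => //; apply: e; rewrite invr_eq0.
  - rewrite size_map (leq_trans (size_polyD _ _)) // geq_max sq size_polyN sq' //.
rewrite amp_true // -/(h rl) -hq qq' hq'; apply: eq_bigr => l lr.
rewrite /coef /column_weight !big_map !big_split /=; ring.
Qed.

End Interpolation.

(** * A recurrence on lists of parameters for the wavefunction *)

Section Recurrence.
Context {C : fieldType}.
Variables (t A B : C).
Implicit Types (us : seq C) (q : seq (C * bool)).

(** The wavefunction without columns: when all outputs are 0, each K-matrix can only contribute B u
    - A and each crossing u d - t. *)
Fixpoint vacuum us : C :=
  if us is u :: us' then (B * u - A) * \prod_(d <- us') (u * d - t) * vacuum us' else 1.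

(* The pairs in q are the spectral parameter and the occupation of a physical
   site, the last site first. *)
Fixpoint wave_rec q us : C :=
  match q with
  | [::] => vacuum us
  | (w, x) :: q' =>
    if x then \sum_(u <- us) column_weight t (rem u us) u w (map fst q')
                             * wave_rec q' (rem u us)
    else \prod_(u <- us) (u - t * w) * wave_rec q' us
  end.

Context {S : finType}.
Implicit Types (U : S -> C) (s : config S) (v : state C S) (p rl : seq S).
Local Notation amp := (amp t A B).

Lemma cross_zero U c rl v s : c \notin rl -> s c = false -> zero_on rl s ->
  cross t U c rl v s = \prod_(d <- rl) (U c * U d - t) * v s.
Proof.
move=> + sc; elim: rl v => [|d rl IH] v /=; first by rewrite big_nil mul1r.
rewrite inE negb_or => /andP[cd cr] z; rewrite IH //; last first.
  by move=> e er; apply: z; rewrite inE er orbT.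
rewrite R_diag // ?big_cons; first by ring.
by apply: z; rewrite inE eqxx.
Qed.

Lemma tot_nil_zero U rl v s : uniq rl -> zero_on rl s ->
  tot t A B U [::] rl v s = vacuum (map U rl) * v s.
Proof.
elim: rl v => [|c rl IH] v /=; first by rewrite mul1r.
move=> /andP[cr ur] z.
have sc : s c = false by apply: z; rewrite inE eqxx.
have z' : zero_on rl s by move=> e er; apply: z; rewrite inE er orbT.
rewrite IH // /transfer /= cross_zero // K_opE sc /K_act (upd_id s) // big_map.
by ring.
Qed.

Lemma amp_rec U p rl s : t != 0 -> {in rl, forall c, U c != 0} ->
  {in rl &, forall c d, c != d -> U d != t * U c} -> {in rl &, injective U} ->
  uniq (rl ++ p) -> (forall c, c \notin p -> s c = false) ->
  amp U p rl s = wave_rec [seq (U b, s b) | b <- p] (map U rl).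
Proof.
move=> t0; elim: p rl s => [|b p IH] rl s U0 Ut Uinj un s0.
  rewrite /amp tot_nil_zero //=; last first.
  - by move=> c _; apply: s0.
  - by move: un; rewrite cats0.
  rewrite ffunE (_ : s == _) ?mulr1 //.
  by apply/eqP/ffunP => c; rewrite ffunE s0.
have z : zero_on rl s.
  by move=> c cr; apply: s0; apply: uniq_catNr un cr.
have url : uniq rl by move: un; rewrite cat_uniq => /andP[].
have bp : b \notin p by move: un; rewrite cat_uniq => /and3P[_ _ /andP[]].
have unp : uniq (rl ++ p).
  apply: subseq_uniq un; apply: cat_subseq => //; exact: subseq_cons.
have [sb|/negbTE sb] := boolP (s b); rewrite /= sb; last first.
  rewrite amp_false // IH // ?big_map // => c cp.
  by have [->//|cb] := eqVneq c b; apply: s0; rewrite inE negb_or cb.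
rewrite amp_true_sum // big_map; apply: eq_big_seq => l lr.
rewrite -map_rem_in // -!map_comp; congr (_ * _).
have sub : {subset rem l rl <= rl} by exact: mem_rem.
rewrite IH //.
- congr (wave_rec _ _); apply/eq_in_map => d dp.
  by rewrite upd_other //; apply: contraNneq bp => <-.
- by move=> c /sub; apply: U0.
- by move=> c d /sub cr /sub dr; apply: Ut.
- by move=> c d /sub cr /sub dr; apply: Uinj.
- by apply: subseq_uniq unp; apply: cat_subseq => //; exact: rem_subseq.
- move=> c cp; have [->|cb] := eqVneq c b; first by rewrite upd_same.
  by rewrite upd_other // s0 // inE negb_or cb.
Qed.

End Recurrence.

(** * The symmetrized sum *)

Section SymmetrizedSum.
Context {C : fieldType}.
Variables (t A B : C).
Implicit Types (v w : nat -> C) (x : nat -> nat).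

(** The term of F with arguments indexed by natural numbers: the recurrence lowers N, n and m, and
    ranges can be shortened or shifted without changing the types of the arguments. *)
Definition summand N n m v w x : C :=
  (\prod_(0 <= j < m) \prod_(0 <= k < N | (x j < k)%N) (v j - t * w k))
  * (\prod_(0 <= j < m) \prod_(0 <= k < m | (j < k)%N)
       ((t * v j - v k) / (v j - v k) * (v j * v k - 1)))
  * (\prod_(m <= j < n) \prod_(0 <= k < N) (v j - t * w k))
  * (\prod_(m <= j < n) \prod_(0 <= k < m)
       ((t * v j - v k) / (v j - v k) * (v j * v k - 1)))
  * (\prod_(0 <= j < m) \prod_(0 <= k < N | (k < x j)%N) (v j - w k))
  * (\prod_(m <= j < n) \prod_(0 <= k < n | (j < k)%N) (v j * v k - t))
  * (\prod_(0 <= j < m) ((1 - t) * (v j ^+ 2 - 1)))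
  * (\prod_(m <= j < n) (B * v j - A)).

Lemma prod_nat_recr_cond n (P : pred nat) (f : nat -> C) :
  \prod_(0 <= k < n.+1 | P k) f k =
  \prod_(0 <= k < n | P k) f k * (if P n then f n else 1).
Proof. by rewrite big_mkcond big_nat_recr //= -big_mkcond. Qed.

Lemma summand_recr_empty N n m v w x : (m <= n)%N ->
  (forall j, (j < m)%N -> (x j < N)%N) ->
  summand N.+1 n m v w x =
  \prod_(0 <= j < n) (v j - t * w N) * summand N n m v w x.
Proof.
move=> mn xN; rewrite /summand (big_cat_nat (leq0n m) mn) /=.
have -> : \prod_(0 <= j < m) \prod_(0 <= k < N.+1 | (x j < k)%N) (v j - t * w k) =
    \prod_(0 <= j < m) \prod_(0 <= k < N | (x j < k)%N) (v j - t * w k) *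
    \prod_(0 <= j < m) (v j - t * w N).
  rewrite -big_split; apply: eq_big_nat => j /= jm.
  by rewrite prod_nat_recr_cond xN.
have -> : \prod_(m <= j < n) \prod_(0 <= k < N.+1) (v j - t * w k) =
    \prod_(m <= j < n) \prod_(0 <= k < N) (v j - t * w k) *
    \prod_(m <= j < n) (v j - t * w N).
  by rewrite -big_split; apply: eq_big_nat => j _; rewrite big_nat_recr.
have -> : \prod_(0 <= j < m) \prod_(0 <= k < N.+1 | (k < x j)%N) (v j - w k) =
    \prod_(0 <= j < m) \prod_(0 <= k < N | (k < x j)%N) (v j - w k).
  apply: eq_big_nat => j /= jm.
  by rewrite prod_nat_recr_cond ltnNge ltnW ?xN // mulr1.
by ring.
Qed.

(** The variables before and after position m receive the same extra factors from position m and
    column N, though from different products of F. Together these give one product over all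
    remaining variables, independent of their order. *)
Lemma summand_recr_occupied N n m v v' w x : (m <= n)%N -> x m = N ->
  (forall j, (j < m)%N -> (x j < N)%N) ->
  (forall j, (j < n)%N -> v (bump m j) = v' j) ->
  summand N.+1 n.+1 m.+1 v w x =
  (1 - t) * (v m ^+ 2 - 1) * \prod_(0 <= k < N) (v m - w k) *
  \prod_(0 <= d < n) ((t * v' d - v m) / (v' d - v m) * (v' d * v m - 1) *
                      (v' d - t * w N)) *
  summand N n m v' w x.
Proof.
move=> mn xm xN vv'.
pose pf (a b : C) := (t * a - b) / (a - b) * (a * b - 1).
have vlo j : (j < m)%N -> v j = v' j.
  by move=> jm; rewrite -vv' ?(leq_trans jm) // /bump leqNgt jm.
have vhi j : (m <= j)%N -> (j < n)%N -> v j.+1 = v' j.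
  by move=> mj jn; rewrite -vv' // /bump mj.
rewrite /summand; set a := v m.
have f1 : \prod_(0 <= j < m.+1) \prod_(0 <= k < N.+1 | (x j < k)%N) (v j - t * w k) =
    \prod_(0 <= j < m) \prod_(0 <= k < N | (x j < k)%N) (v' j - t * w k) *
    \prod_(0 <= j < m) (v' j - t * w N).
  rewrite big_nat_recr //= [X in _ * X]big_nat_cond [X in _ * X]big1 ?mulr1; last first.
    move=> k /andP[/andP[_ kN]]; rewrite xm ltnNge -ltnS kN //.
  rewrite -big_split; apply: eq_big_nat => j /= jm.
  by rewrite prod_nat_recr_cond xN // vlo.
have f2 : \prod_(0 <= j < m.+1) \prod_(0 <= k < m.+1 | (j < k)%N) pf (v j) (v k) =
    \prod_(0 <= j < m) \prod_(0 <= k < m | (j < k)%N) pf (v' j) (v' k) *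
    \prod_(0 <= j < m) pf (v' j) a.
  rewrite big_nat_recr //= [X in _ * X]big_nat_cond [X in _ * X]big1 ?mulr1; last first.
    by move=> k /andP[/andP[_ km]]; rewrite ltnNge -ltnS km.
  rewrite -big_split; apply: eq_big_nat => j /= jm.
  rewrite prod_nat_recr_cond jm vlo //; congr (_ * _).
  rewrite big_nat_cond [RHS]big_nat_cond.
  by apply: eq_bigr => k /andP[km _]; rewrite vlo.
have f3 : \prod_(m.+1 <= j < n.+1) \prod_(0 <= k < N.+1) (v j - t * w k) =
    \prod_(m <= j < n) \prod_(0 <= k < N) (v' j - t * w k) *
    \prod_(m <= j < n) (v' j - t * w N).
  rewrite big_add1 -big_split /=; apply: eq_big_nat => j /andP[mj jn].
  by rewrite big_nat_recr //= vhi.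
have f4 : \prod_(m.+1 <= j < n.+1) \prod_(0 <= k < m.+1) pf (v j) (v k) =
    \prod_(m <= j < n) \prod_(0 <= k < m) pf (v' j) (v' k) *
    \prod_(m <= j < n) pf (v' j) a.
  rewrite big_add1 -big_split /=; apply: eq_big_nat => j /andP[mj jn].
  rewrite big_nat_recr //= vhi //; congr (_ * _).
  by apply: eq_big_nat => k /= km; rewrite vlo.
have f5 : \prod_(0 <= j < m.+1) \prod_(0 <= k < N.+1 | (k < x j)%N) (v j - w k) =
    \prod_(0 <= j < m) \prod_(0 <= k < N | (k < x j)%N) (v' j - w k) *
    \prod_(0 <= k < N) (a - w k).
  rewrite big_nat_recr //=; congr (_ * _).
    apply: eq_big_nat => j /= jm.
    by rewrite prod_nat_recr_cond ltnNge ltnW ?xN // mulr1 vlo.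
  rewrite prod_nat_recr_cond xm ltnn mulr1 big_nat_cond [RHS]big_nat_cond.
  by apply: eq_bigl => k; case: (k < N)%N; rewrite ?andbF.
have f6 : \prod_(m.+1 <= j < n.+1) \prod_(0 <= k < n.+1 | (j < k)%N) (v j * v k - t) =
    \prod_(m <= j < n) \prod_(0 <= k < n | (j < k)%N) (v' j * v' k - t).
  rewrite big_add1 /=; apply: eq_big_nat => j /andP[mj jn].
  rewrite big_mkcond big_nat_recl //= mul1r -big_mkcond /=.
  rewrite big_nat_cond [RHS]big_nat_cond; apply: eq_bigr => k /andP[kn jk].
  by rewrite !vhi // (leq_trans mj) // ltnW.
have f7 : \prod_(0 <= j < m.+1) ((1 - t) * (v j ^+ 2 - 1)) =
    \prod_(0 <= j < m) ((1 - t) * (v' j ^+ 2 - 1)) * ((1 - t) * (a ^+ 2 - 1)).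
  rewrite big_nat_recr //=; congr (_ * _).
  by apply: eq_big_nat => j /= jm; rewrite vlo.
have f8 : \prod_(m.+1 <= j < n.+1) (B * v j - A) = \prod_(m <= j < n) (B * v' j - A).
  by rewrite big_add1; apply: eq_big_nat => j /andP[mj jn]; rewrite vhi.
have f9 : \prod_(0 <= d < n) (pf (v' d) a * (v' d - t * w N)) =
    \prod_(0 <= j < m) pf (v' j) a * \prod_(m <= j < n) pf (v' j) a *
    (\prod_(0 <= j < m) (v' j - t * w N) * \prod_(m <= j < n) (v' j - t * w N)).
  by rewrite big_split !(big_cat_nat (leq0n m) mn).
rewrite f1 f2 f3 f4 f5 f6 f7 f8 f9 /pf.
by ring.
Qed.

(** The value 0 outside the range is only a filler: all products in [summand] stay within the
    range. *)
Definition extend0 {n} (f : 'I_n -> C) (k : nat) : C :=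
  oapp f 0 (insub k : option 'I_n).

Lemma extend0_ord n (f : 'I_n -> C) (i : 'I_n) : extend0 f i = f i.
Proof. by rewrite /extend0 valK. Qed.

Definition symm_sum N {n} m (u : 'I_n -> C) w x : C :=
  ((n - m)`!)%:R^-1 * \sum_(s : 'S_n) summand N n m (extend0 (fun i => u (s i))) w x.

(** A permutation is determined by the image l of [i0] and the permutation it induces on the
    remaining points; injectivity and the count (n+1)! = (n+1) n! suffice. *)
Lemma sum_lift_perm n (i0 : 'I_n.+1) (f : 'S_n.+1 -> C) :
  \sum_(s : 'S_n.+1) f s = \sum_(l < n.+1) \sum_(s : 'S_n) f (lift_perm i0 l s).
Proof.
rewrite pair_bigA /= (reindex (fun q : 'I_n.+1 * 'S_n => lift_perm i0 q.1 q.2)) //=.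
apply: onW_bij; apply: inj_card_bij; last first.
  by rewrite card_prod card_ord !card_Sn factS.
move=> [l s] [l' s'] /= e.
have ll' : l = l' by rewrite -(lift_perm_id i0 l s) e lift_perm_id.
rewrite -ll' in e *; congr (_, _); apply/permP => i.
by apply: (@lift_inj _ l); rewrite -(lift_perm_lift i0) e lift_perm_lift.
Qed.

Lemma prod_extend0_perm n (u : 'I_n -> C) (s : 'S_n) (f : C -> C) :
  \prod_(0 <= d < n) f (extend0 (fun i => u (s i)) d) = \prod_(d < n) f (u d).
Proof.
rewrite big_mkord [RHS](reindex_inj (@perm_inj _ s)).
by apply: eq_bigr => i _; rewrite extend0_ord.
Qed.

Lemma symm_sum_recr_empty N n m (u : 'I_n -> C) w x : (m <= n)%N ->
  (forall j, (j < m)%N -> (x j < N)%N) ->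
  symm_sum N.+1 m u w x = \prod_(d < n) (u d - t * w N) * symm_sum N m u w x.
Proof.
move=> mn xN; rewrite /symm_sum mulrCA; congr (_ * _); rewrite mulr_sumr.
apply: eq_bigr => s _; rewrite summand_recr_empty //.
by rewrite (prod_extend0_perm _ u s (fun z => z - t * w N)).
Qed.

(** Both n and m drop by one, so the factor 1/(n-m)! is unchanged and no combinatorial constant
    appears. *)
Lemma symm_sum_recr_occupied N n m (u : 'I_n.+1 -> C) w x (ws : seq C) : (m <= n)%N ->
  x m = N -> (forall j, (j < m)%N -> (x j < N)%N) ->
  perm_eq ws [seq w k | k <- iota 0 N] ->
  symm_sum N.+1 m.+1 u w x =
  \sum_(l < n.+1)
    column_weight t [seq u (lift l i) | i <- enum 'I_n] (u l) (w N) ws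
    * symm_sum N m (fun i => u (lift l i)) w x.
Proof.
move=> mn xm xN pws; rewrite /symm_sum subSS.
pose i0 : 'I_n.+1 := Ordinal (mn : (m < n.+1)%N).
rewrite (sum_lift_perm n i0) mulr_sumr; apply: eq_bigr => l _.
rewrite mulrCA; congr (_ * _); rewrite mulr_sumr; apply: eq_bigr => s _.
pose v' := extend0 (fun i => u (lift l (s i))).
rewrite (summand_recr_occupied N n m _ v') //; last first.
  move=> j jn; pose i := Ordinal jn.
  have -> : bump m j = lift i0 i by [].
  by rewrite /v' -[j]/(val i) !extend0_ord lift_perm_lift.
have -> : extend0 (fun i => u (lift_perm i0 l s i)) m = u l.
  by rewrite -[m]/(val i0) extend0_ord lift_perm_id.
congr (_ * _); rewrite /column_weight big_map big_enum /=.
rewrite (perm_big _ pws) big_map; congr (_ * _ * _).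
  by rewrite /index_iota subn0.
exact: (prod_extend0_perm _ (fun i => u (lift l i)) s
  (fun z => (t * z - u l) / (z - u l) * (z * u l - 1) * (z - t * w N))).
Qed.

(** This makes all terms of the symmetrization equal once no column is left. *)
Lemma perm_vacuum us us' : perm_eq us us' -> vacuum t A B us = vacuum t A B us'.
Proof.
apply: perm_swap_ind => pre a b rest _; elim: pre => [|c pre IH] /=.
  by rewrite !big_cons; ring.
rewrite IH; congr (_ * _ * _); apply: perm_big; exact: perm_cat_swap.
Qed.

Lemma summand00 n v w x : summand 0 n 0 v w x = vacuum t A B (mkseq v n).
Proof.
have e0 (f : nat -> C) : \prod_(0 <= j < 0) f j = 1 by rewrite big_geq.
have e1 (f : nat -> nat -> C) : \prod_(0 <= j < n) \prod_(0 <= k < 0) f j k = 1.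
  by rewrite big1 // => j _; rewrite e0.
rewrite /summand !e0 !e1 !mul1r !mulr1 {e0 e1}.
elim: n v => [|n IH] v; first by rewrite !big_geq // mulr1.
have shift (P : pred nat) (f : nat -> C) : P 0%N = false ->
    \prod_(0 <= k < n.+1 | P k) f k = \prod_(0 <= k < n | P k.+1) f k.+1.
  by move=> P0; rewrite big_mkcond big_nat_recl // P0 /= mul1r -big_mkcond.
have -> : mkseq v n.+1 = v 0%N :: mkseq (v \o succn) n.
  by rewrite /mkseq /= -[1%N]/(1 + 0)%N iotaDl -map_comp.
rewrite [vacuum _ _ _ _]/= -IH !big_nat_recl //= shift //.
have -> : \prod_(0 <= j < n) \prod_(0 <= k < n.+1 | (j.+1 < k)%N) (v j.+1 * v k - t) =
    \prod_(0 <= j < n) \prod_(0 <= k < n | (j < k)%N) (v j.+1 * v k.+1 - t).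
  by apply: eq_bigr => j _; rewrite shift.
by rewrite /mkseq big_map /index_iota subn0; ring.
Qed.

Lemma map_perm_enum n (u : 'I_n -> C) (s : 'S_n) :
  perm_eq [seq u (s i) | i <- enum 'I_n] [seq u i | i <- enum 'I_n].
Proof.
rewrite (map_comp u s); apply: perm_map; apply: uniq_perm; last 1 first.
- by move=> i; rewrite mem_enum; apply/mapP; exists (s^-1 i)%g; rewrite ?mem_enum // permKV.
- by rewrite map_inj_uniq ?enum_uniq //; exact: perm_inj.
- exact: enum_uniq.
Qed.

Lemma map_lift_enum n (u : 'I_n.+1 -> C) l :
  perm_eq (u l :: [seq u (lift l i) | i <- enum 'I_n]) [seq u i | i <- enum 'I_n.+1].
Proof.
rewrite (map_comp u (lift l)) -map_cons; apply: perm_map; apply: uniq_perm; last 1 first.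
- move=> i; rewrite mem_enum inE; case: (unliftP l i) => [j ->|->]; last by rewrite eqxx.
  by apply/orP; right; apply/mapP; exists j; rewrite ?mem_enum.
- rewrite /= map_inj_uniq ?enum_uniq ?andbT; last exact: lift_inj.
  by apply/mapP => -[i _ /eqP]; rewrite (negbTE (neq_lift _ _)).
- exact: enum_uniq.
Qed.

(** The parameters are taken up to permutation, because removing a value from a list and skipping an
    index by [lift] agree only as multisets. *)
Lemma symm_sum_rec N n m (u : 'I_n -> C) w x (o : nat -> bool) us :
  (forall k, (k`!)%:R != 0 :> C) -> (m <= n)%N ->
  (forall i j, (i < j)%N -> (j < m)%N -> (x i < x j)%N) ->
  (forall j, (j < m)%N -> (x j < N)%N) ->
  (forall k, (k < N)%N -> reflect (exists2 j, (j < m)%N & x j = k) (o k)) ->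
  perm_eq us [seq u i | i <- enum 'I_n] ->
  symm_sum N m u w x = wave_rec t A B (rev [seq (w k, o k) | k <- iota 0 N]) us.
Proof.
move=> char0; elim: N n m u us => [|N IH] n m u us mn xinc xN oP usE.
  case: m mn xinc xN {oP} => [|m] mn xinc xN; last by have := xN 0%N isT.
  (* Without columns m = 0, and the n! equal terms cancel the prefactor 1/n!. *)
  rewrite /symm_sum subn0 (eq_bigr (fun=> vacuum t A B us)) => [|s _].
    rewrite sumr_const card_Sn -[X in _ * X = _]mulr_natl mulKf //.
  rewrite summand00; apply: perm_vacuum.
  have -> : mkseq (extend0 (fun i => u (s i))) n = [seq u (s i) | i <- enum 'I_n].
    rewrite /mkseq -val_enum_ord -map_comp; apply: eq_map => i /=.
    exact: extend0_ord.
  by rewrite perm_sym (perm_trans usE) // perm_sym map_perm_enum.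
rewrite -[in RHS]addn1 iotaD map_cat rev_cat /= add0n.
have xlast j : (j < m)%N -> x j = N -> j.+1 = m.
  move=> jm xj; apply/eqP; rewrite eqn_leq jm leqNgt; apply/negP => jm'.
  by have := xinc j j.+1 (ltnSn j) jm'; rewrite xj ltnNge -ltnS xN.
have [oN|oN] := oP N (ltnSn N).
  (* As x increases, only its last entry can equal N; hence m = j + 1, and n is positive too. *)
  have [j jm xj] := oN; have := xlast j jm xj => mE; rewrite -mE in mn xinc xN oP *.
  case: n u usE mn => [//|n] u usE; rewrite ltnS => mn.
  rewrite (symm_sum_recr_occupied N n j u w x
    (map fst (rev [seq (w k, o k) | k <- iota 0 N]))) //; first last.
  - by rewrite map_rev -map_comp perm_rev.
  - by move=> i ij; have := xinc i j ij (ltnSn j); rewrite xj.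
  rewrite (perm_big _ usE) big_map big_enum /=; apply: eq_bigr => l _.
  have pl : perm_eq (rem (u l) us) [seq u (lift l i) | i <- enum 'I_n].
    have pE := map_lift_enum _ u l; rewrite perm_sym -(permPl usE) in pE.
    rewrite -(perm_cons (u l)) -(permPr pE) perm_sym perm_to_rem //.
    by rewrite (perm_mem pE) inE eqxx.
  congr (_ * _).
    by rewrite /column_weight (perm_big _ pl).
  apply: IH => //.
  - by move=> i k ik kj; apply: xinc => //; apply: ltnW.
  - by move=> i ij; have := xinc i j ij (ltnSn j); rewrite xj.
  - move=> k kN; apply: (iffP (oP k (ltnW kN))) => -[i ij xi].
      exists i => //; move: ij; rewrite ltnS leq_eqVlt => /orP[/eqP ij|//].
      by move: kN; rewrite -xi ij xj ltnn.
    by exists i => //; apply: ltnW.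
have xN' j : (j < m)%N -> (x j < N)%N.
  move=> jm; rewrite ltn_neqAle -ltnS xN // andbT.
  by apply/eqP => xj; apply: oN; exists j.
rewrite symm_sum_recr_empty // (perm_big _ usE) big_map big_enum /=; congr (_ * _).
by apply: IH => // k kN; apply: oP; apply: ltnW.
Qed.

End SymmetrizedSum.

(** * Polynomiality in t *)

Section PolynomialFunctions.
Context {F : fieldType}.

Definition polyfun (f : F -> F) : Prop := exists p : {poly F}, forall t, f t = p.[t].

Lemma polyfun_const a : polyfun (fun=> a).
Proof. by exists a%:P => t; rewrite hornerC. Qed.

Lemma polyfun_id : polyfun id.
Proof. by exists 'X => t; rewrite hornerX. Qed.

Lemma polyfunB f g : polyfun f -> polyfun g -> polyfun (fun t => f t - g t).
Proof. by move=> [p hp] [q hq]; exists (p - q) => t; rewrite !hornerE hp hq. Qed.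

Lemma polyfunM f g : polyfun f -> polyfun g -> polyfun (fun t => f t * g t).
Proof. by move=> [p hp] [q hq]; exists (p * q) => t; rewrite hornerM hp hq. Qed.

Lemma polyfun_sum (I : Type) (r : seq I) (P : pred I) (f : I -> F -> F) :
  (forall i, polyfun (f i)) -> polyfun (fun t => \sum_(i <- r | P i) f i t).
Proof.
move=> hf; elim: r => [|i r [p hp]].
  by exists 0 => t; rewrite big_nil horner0.
have [q hq] := hf i; exists (if P i then q + p else p) => t.
by rewrite big_cons hp hq; case: (P i); rewrite ?hornerD.
Qed.

Lemma polyfun_prod (I : Type) (r : seq I) (P : pred I) (f : I -> F -> F) :
  (forall i, polyfun (f i)) -> polyfun (fun t => \prod_(i <- r | P i) f i t).
Proof.
move=> hf; elim: r => [|i r [p hp]].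
  by exists 1 => t; rewrite big_nil hornerC.
have [q hq] := hf i; exists (if P i then q * p else p) => t.
by rewrite big_cons hp hq; case: (P i); rewrite ?hornerM.
Qed.

Context {S : finType}.

(** The entries of R are polynomial in t and those of K free of t; an amplitude is a finite sum of
    products of such entries. *)
Lemma polyfun_tot A B (U : S -> F) p rl s :
  polyfun (fun t => amp t A B U p rl s).
Proof.
pose ps (v : F -> state F S) := forall s, polyfun (fun t => v t s).
have psR a b x y v : ps v -> ps (fun t => R_op t a b x y (v t)).
  move=> hv s'; have [p' hp'] : polyfun (fun t => \sum_(s'' : config S)
      R_elt t x y (s' a) (s' b) (s'' a) (s'' b) * (agree_off [set a; b] s' s'')%:R * v t s'').
    apply: polyfun_sum => s''; apply: polyfunM; last exact: hv.
    apply: polyfunM; last exact: polyfun_const.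
    case: (s' a); case: (s' b); case: (s'' a); case: (s'' b) => /=;
      repeat first [apply: polyfun_const | apply: polyfun_id
                   | apply: polyfunB | apply: polyfunM].
  by exists p' => t; rewrite ffunE hp'.
have psK a x v : ps v -> ps (fun t => K_op A B a x (v t)).
  move=> hv s'; have [p' hp'] : polyfun (fun t => \sum_(s'' : config S)
      K_elt A B x (s' a) (s'' a) * (agree_off [set a] s' s'')%:R * v t s'').
    by apply: polyfun_sum => s''; apply: polyfunM; [exact: polyfun_const|exact: hv].
  by exists p' => t; rewrite ffunE hp'.
have psline c q v : ps v -> ps (fun t => line t U c q (v t)).
  by move=> hv; elim: q => //= b q IH; apply: psR.
have pscross c q v : ps v -> ps (fun t => cross t U c q (v t)).
  elim: q v => //= b q IH v hv.
  by apply: (IH (fun t => R_op t c b (U c * U b) 1 (v t))); apply: psR.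
suff pstot v : ps v -> ps (fun t => tot t A B U p rl (v t)).
  by apply: (pstot (fun=> ket F [ffun=> false])) => s'; exact: polyfun_const.
elim: rl v {s} => //= c rl IH v hv.
apply: (IH (fun t => transfer t A B U c p rl (v t))).
by apply: psline; apply: pscross; apply: psK.
Qed.

(** In F the variable t occurs only in numerators, so each quotient is a polynomial in t times a
    constant. *)
Lemma polyfun_F_sum N n m (A B : F) (u : 'I_n -> F) (w : 'I_N -> F) (hmn : (m <= n)%N)
    (x : 'I_m -> 'I_N) : polyfun (fun t => F_sum t A B u w hmn x).
Proof.
rewrite /F_sum; apply: polyfunM; first exact: polyfun_const.
apply: polyfun_sum => s /=.
repeat first [apply: polyfun_const | apply: polyfun_id
  | apply: polyfunB | apply: polyfunM | apply: polyfun_prod => ?].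
Qed.

End PolynomialFunctions.

Lemma polyfun_eq_off (F : numFieldType) (f g : F -> F) (bad : seq F) :
  polyfun f -> polyfun g -> (forall t, t \notin bad -> f t = g t) -> forall t, f t = g t.
Proof.
move=> [p hp] [q hq] fg t; rewrite hp hq; congr (_.[t]); apply/eqP.
rewrite -subr_eq0; have : (p - q) * \prod_(b <- bad) ('X - b%:P) == 0.
  (* The product vanishes at every point, on [bad] by its second factor and elsewhere by its first.
     As many natural numbers as its size, distinct in characteristic 0, then force it to be 0. *)
  set r := _ * _; apply/eqP.
  apply: (roots_geq_poly_eq0 (rs := [seq k%:R | k <- iota 0 (size r)])).
  - apply/allP => z _; rewrite /root /r hornerM horner_prod.
    have [zb|/fg e] := boolP (z \in bad).
      by rewrite [X in _ * X](big_rem z) //= hornerXsubC subrr mul0r mulr0.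
    by rewrite hornerD hornerN -hp -hq e subrr mul0r.
  - by rewrite map_inj_uniq ?iota_uniq //; exact: Num.Theory.mulrIn (oner_neq0 _).
  - by rewrite size_map size_iota.
rewrite mulf_eq0 => /orP[//|]; rewrite prodf_seq_eq0 => /hasP[b _].
by rewrite /= polyXsubC_eq0.
Qed.

(** * Identification of the wavefunction and of F with the list formulations *)

Section Identification.
Context {F : fieldType} {N n : nat}.
Variables (t A B : F) (u : 'I_n -> F) (w : 'I_N -> F).

Definition site_param (c : site N n) : F :=
  match c with inl j => u j | inr k => w k end.

Lemma F_sumE m (hmn : (m <= n)%N) (x : 'I_m -> 'I_N) :
  F_sum t A B u w hmn x =
  symm_sum t A B N m u (extend0 w) (fun j => oapp (fun i => val (x i)) 0%N (insub j)).
Proof.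
rewrite /F_sum /symm_sum; congr (_ * _); apply: eq_bigr => s _ /=.
pose xn (j : nat) := oapp (fun i : 'I_m => val (x i)) 0%N (insub j).
rewrite -[X in summand _ _ _ _ _ _ _ _ X]/xn; set v := extend0 _.
have xnE (j : 'I_m) : xn j = x j by rewrite /xn valK.
have vE (j : 'I_n) : v j = u (s j) by rewrite /v extend0_ord.
have vmE (j : 'I_m) : v j = u (s (widen_ord hmn j)) by rewrite -vE.
have lo k (f : nat -> F) (g : 'I_k -> F) : (forall j : 'I_k, g j = f j) ->
    \prod_(j < k) g j = \prod_(0 <= j < k) f j.
  by move=> e; rewrite big_mkord; apply: eq_bigr => j _.
have hi (f : nat -> F) (g : 'I_n -> F) : (forall j : 'I_n, g j = f j) ->
    \prod_(j < n | (m <= j)%N) g j = \prod_(m <= j < n) f j.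
  by move=> e; rewrite big_geq_mkord; apply: eq_bigr => j _.
have inner k (P : pred 'I_k) (Q : pred nat) (f : nat -> F) (g : 'I_k -> F) :
    (forall j : 'I_k, P j = Q j) ->
    (forall j : 'I_k, g j = f j) ->
    \prod_(j < k | P j) g j = \prod_(0 <= j < k | Q j) f j.
  by move=> e e'; rewrite big_mkord; apply: eq_big => j.
rewrite /summand; do 7?congr (_ * _).
- by apply: lo => j; apply: inner => k; rewrite ?xnE // vmE extend0_ord.
- by apply: lo => j; apply: inner => k //; rewrite !vmE.
- by apply: hi => j; apply: lo => k; rewrite vE extend0_ord.
- by apply: hi => j; apply: lo => k; rewrite vE vmE.
- by apply: lo => j; apply: inner => k; rewrite ?xnE // vmE extend0_ord.
- by apply: hi => j; apply: inner => k //; rewrite !vE.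
- by apply: lo => j; rewrite vmE.
- by apply: hi => j; rewrite vE.
Qed.

Lemma big_comp_foldr (T I : Type) (r : seq I) (f : I -> T -> T) (v : T) :
  (\big[comp/id]_(i <- r) f i) v = foldr f v r.
Proof. by elim: r => [|i r IH]; rewrite ?big_nil ?big_cons //= IH. Qed.

Lemma filter_enum_ltn j : [seq i : 'I_n <- enum 'I_n | (i < j)%N] = take j (enum 'I_n).
Proof.
apply: (inj_map val_inj); rewrite -(filter_map (@nat_of_ord n) (fun i => i < j)%N).
rewrite map_take val_enum_ord take_iota.
have [jn|nj] := leqP j n.
  by rewrite -{1}[j]add0n filter_iota_ltn.
apply/all_filterP/allP => i.
by rewrite mem_iota => /andP[_ /leq_trans]; apply; apply: ltnW.
Qed.

(** The operator product in [T_op] lists the crossings with the last to act first, while [cross]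
    starts from the head; hence the reversal. *)
Lemma cross_rev U c (r : seq (site N n)) v :
  cross t U c (rev r) v = foldr (fun d => R_op t c d (U c * U d) 1) v r.
Proof.
have rc r' a v' : cross t U c (rcons r' a) v' = R_op t c a (U c * U a) 1 (cross t U c r' v').
  by elim: r' v' => //= b r' IH v'; rewrite IH.
by elim: r => //= a r IH; rewrite rev_cons rc IH.
Qed.

Lemma index_enumE (T : finType) : index_enum T = enum T.
Proof. by rewrite enumT [index_enum _]unlock. Qed.

Let physl : seq (site N n) := map inr (rev (enum 'I_N)).

Lemma T_opE (j : 'I_n) v :
  T_op t A B u w j v =
  transfer t A B site_param (inl j) physl (rev (map inl (take j (enum 'I_n)))) v.
Proof.
rewrite /T_op /transfer /= cross_rev big_comp_foldr.
set v' := K_op _ _ _ _ _.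
have -> : (\big[comp/id]_(i < n | (i < j)%N) R_op t (aux N j) (aux N i) (u j * u i) 1) v' =
   foldr (fun d => R_op t (inl j) d (u j * site_param d) 1) v' (map inl (take j (enum 'I_n))).
  by rewrite index_enumE -big_filter filter_enum_ltn big_comp_foldr foldr_map.
by rewrite /physl; elim: (rev _) => //= b r ->.
Qed.

Lemma tot_site v k : (k <= n)%N ->
  tot t A B site_param physl (rev (map inl (take k (enum 'I_n)))) v =
  foldr (T_op t A B u w) v (take k (enum 'I_n)).
Proof.
elim: k v => [|k IH] v kn; first by rewrite take0.
pose k0 := Ordinal kn.
have -> : take k.+1 (enum 'I_n) = rcons (take k (enum 'I_n)) k0.
  rewrite (take_nth k0) ?size_enum_ord //; congr rcons.
  by apply: val_inj; rewrite /= nth_enum_ord.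
rewrite map_rcons rev_rcons /= foldr_rcons -IH; last exact: ltnW.
by rewrite T_opE.
Qed.

Lemma wavefunctionE m (x : 'I_m -> 'I_N) :
  wavefunction t A B u w x =
  amp t A B site_param physl (rev (map inl (enum 'I_n)))
    (join_config [ffun=> false] [ffun k => [exists i, x i == k]]).
Proof.
have := tot_site (Omega F N n) n (leqnn n).
rewrite !take_oversize ?size_enum_ord // /amp => ->.
rewrite /wavefunction /Psi ffunE -big_comp_foldr.
by rewrite index_enumE.
Qed.

Lemma wavefunction_generic m (hmn : (m <= n)%N) (x : 'I_m -> 'I_N) :
  (forall k, (k`!)%:R != 0 :> F) -> (forall i j : 'I_m, (i < j)%N -> (x i < x j)%N) ->
  (forall j, u j != 0) -> injective u -> t != 0 ->
  (forall i j, i != j -> u j != t * u i) ->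
  wavefunction t A B u w x = F_sum t A B u w hmn x.
Proof.
move=> char0 xinc u0 uinj t0 ut; rewrite wavefunctionE amp_rec //; first last.
- move=> [j|k]; first by rewrite !ffunE.
  by rewrite /physl mem_map ?mem_rev ?mem_enum //; move=> ? ? [].
- rewrite cat_uniq rev_uniq !map_inj_uniq ?rev_uniq ?enum_uniq //; try by move=> ? ? [].
  rewrite andbT -enumT enum_uniq /=; apply/hasPn => _ /mapP[k _ ->].
  by rewrite mem_rev; apply/mapP => -[].
- move=> c d; rewrite !mem_rev => /mapP[i _ ->] /mapP[j _ ->] /= /uinj -> //.
- move=> c d; rewrite !mem_rev => /mapP[i _ ->] /mapP[j _ ->] ij /=.
  by apply: ut; apply: contraNneq ij => ->.
- by move=> c; rewrite mem_rev => /mapP[i _ ->] /=.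
pose o k := [exists i, val (x i) == k].
have xnE j (jm : (j < m)%N) :
    oapp (fun i : 'I_m => val (x i)) 0%N (insub j) = val (x (Ordinal jm)).
  by rewrite insubT.
rewrite F_sumE (symm_sum_rec _ _ _ _ _ _ _ _ _ o
  (map site_param (rev (map inl (enum 'I_n))))) //.
- congr wave_rec; rewrite /physl -map_comp map_rev; congr rev.
  rewrite -val_enum_ord -map_comp; apply: eq_map => k /=.
  by rewrite extend0_ord !ffunE.
- move=> i j ij jm; have im := ltn_trans ij jm.
  by rewrite (xnE _ im) (xnE _ jm); apply: xinc.
- by move=> j jm; rewrite (xnE _ jm); exact: ltn_ord.
- move=> k kN; apply: (iffP existsP) => [[i /eqP <-]|[j jm]].
    by exists (nat_of_ord i) => //; rewrite (xnE _ (ltn_ord i));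
      congr (val (x _)); apply: val_inj.
  by rewrite (xnE _ jm) => <-; exists (Ordinal jm).
- by rewrite map_rev -map_comp perm_rev.
Qed.

End Identification.

Theorem theorem5p2 (R : realType) (N n m : nat)
    (hN : (1 <= N)%N) (hn : (1 <= n)%N) (hmn : (m <= n)%N) (hmN : (m <= N)%N)
    (x : 'I_m -> 'I_N) (hx : forall i j : 'I_m, (i < j)%N -> (x i < x j)%N)
    (t A B : R[i]) (w : 'I_N -> R[i])
    (u : 'I_n -> R[i]) (hu0 : forall j : 'I_n, u j != 0) (hu : injective u) :
  wavefunction t A B u w x = F_sum t A B u w hmn x.
Proof.
(* All pairs are taken for simplicity; the diagonal ones merely add the value 1, which the
   polynomial argument covers as well. *)
pose bad := 0 :: [seq u q.2 / u q.1 | q : 'I_n * 'I_n].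
apply: (polyfun_eq_off _ (fun t => wavefunction t A B u w x)
  (fun t => F_sum t A B u w hmn x) bad).
- have [p hp] := polyfun_tot A B (site_param u w) (map inr (rev (enum 'I_N)))
    (rev (map inl (enum 'I_n)))
    (join_config [ffun=> false] [ffun k => [exists i, x i == k]]).
  by exists p => t'; rewrite wavefunctionE hp.
- exact: polyfun_F_sum.
move=> t'; rewrite inE negb_or => /andP[t0 tbad].
apply: wavefunction_generic => //.
  by move=> k; rewrite Num.Theory.pnatr_eq0 -lt0n fact_gt0.
move=> i j ij; apply: contraNneq tbad => e.
apply/mapP; exists (i, j); first by rewrite mem_enum.
by rewrite /= e mulfK.
Qed.
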